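(* Let $\mu_n^{\Xi}$ and $\mu_n^{\Lambda}$ be the empirical zero measures associated with the polynomials $\widetilde{\Xi}_n(y)=\Xi_n(\sqrt y)$ and $\widetilde{\Lambda}_n(y)=\Lambda_n(\sqrt y)$, respectively (defined in the context), and let $$F_n^{\Xi}(x):=\mu_n^{\Xi}((-\infty,x]),\qquad F_n^{\Lambda}(x):=\mu_n^{\Lambda}((-\infty,x]),\qquad x\in\mathbb{R},$$ be their distribution functions. Then, as $n\to\infty$, $F_n^{\Xi}(x)$ and $F_n^{\Lambda}(x)$ converge pointwise on $\mathbb{R}$ to the same function $$F(x):=\begin{cases}0, & x\le 0,\\[1mm] \displaystyle \frac{2}{\pi}\arctan\!\left(\frac{1}{\pi}\log\frac{1+\sqrt{x}}{1-\sqrt{x}}\right), & 0<x<1,\\[3mm] 1, & x\ge 1.\end{cases}$$ In particular, the empirical distribution functions associated with the real zeros of $\widetilde{\Xi}_n$ and $\widetilde{\Lambda}_n$ in $(0,1)$ converge to $F$ at every continuity point of $F$.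
   Context: Binomial coefficients satisfy $\binom{m}{\ell}=0$ whenever $\ell<0$ or $\ell>m$. The Eulerian number of type $A$, $\left\langle{m\atop k}\right\rangle$ ($m\ge1$, $0\le k\le m-1$), is the number of permutations of $\{1,\dots,m\}$ with exactly $k$ descents; equivalently $\sum_{j\ge0}(j+1)^m x^j=(1-x)^{-m-1}\sum_{k=0}^{m-1}\left\langle{m\atop k}\right\rangle x^k$ for $|x|<1$. The Eulerian number of type $B$, $\left\langle{m\atop k}\right\rangle^{B}$ ($m\ge0$, $0\le k\le m$), is determined by $\sum_{j\ge0}(2j+1)^m x^j=(1-x)^{-m-1}\sum_{k=0}^{m}\left\langle{m\atop k}\right\rangle^{B} x^k$ for $|x|<1$. For $n\ge1$ and $0\le t\le n-1$ let $$\mathcal C^{(B)}_{n,t}:=\sum_{k=0}^{n-1}\left\langle {2n-1 \atop k}\right\rangle^{B}(-1)^{k}\sum_{i=0}^{k}(-1)^i\binom{k}{i}\binom{2n-2k-1}{2t-2i+1},\quad \mathcal C^{(A)}_{n,t}:=\sum_{k=0}^{n-1}\left\langle {2n \atop k}\right\rangle(-1)^{k}\sum_{i=0}^{k}(-1)^i\binom{k}{i}\binom{2n-2k-1}{2t-2i+1},$$ $$\Xi_n(x):=\frac{(-1)^{n+1}}{2^{4n-2}(2n-1)!}\sum_{t=0}^{n-1}\mathcal C^{(B)}_{n,t}\,x^{2t},\qquad \Lambda_n(x):=\frac{2(-1)^{n+1}}{(2^{2n+1}-1)(2n)!}\sum_{t=0}^{n-1}\mathcal C^{(A)}_{n,t}\,x^{2t}.$$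 These are even polynomials, and $\widetilde{\Xi}_n(y):=\Xi_n(\sqrt y)$, $\widetilde{\Lambda}_n(y):=\Lambda_n(\sqrt y)$ denote the polynomials in $y$ (of degree $n-1$) obtained by replacing $x^2$ by $y$. For $n\ge2$ all their zeros are real, simple and lie in $(0,1)$. The empirical zero measure of such a polynomial with zeros $\rho_1,\dots,\rho_{n-1}$ is the probability measure $\frac1{n-1}\sum_{k=1}^{n-1}\delta_{\rho_k}$ on $\mathbb R$. *)

(* Defs.v *)
From HB Require Import structures.
From mathcomp Require Import all_boot all_order all_algebra all_fingroup.
From mathcomp Require Import all_classical all_reals all_analysis.
From mathcomp Require Import polyrcf.
From mathcomp Require Import ring lra.

Set Implicit Arguments.
Unset Strict Implicit.
Unset Printing Implicit Defensive.

Import Order.TTheory GRing.Theory Num.Theory.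
Import numFieldNormedType.Exports.

Local Open Scope classical_set_scope.
Local Open Scope ring_scope.

(* Total binomial coefficient: the lower index is an integer, so that it may be
   negative (the truncated subtraction of nat would give 'C(m, 0) = 1). *)
Definition binz (m : nat) (l : int) : nat :=
  match l with Posz k => 'C(m, k) | Negz _ => 0%N end.

Definition descents (m : nat) (s : 'S_m) : {set 'I_m} :=
  [set i : 'I_m | [exists j : 'I_m, (j == i.+1 :> nat) && (s j < s i)%N]].

Definition eulerianA (m k : nat) : nat :=
  #|[set s : 'S_m | #|descents s| == k]|.

Section Defs.
Variable R : realType.
Implicit Types (p : {poly R}) (m n t : nat) (x : R).

Definition is_eulerianB_poly m p : Prop :=
  (size p <= m.+1)%N /\
  forall x, `|x| < 1 ->
    series (fun j => (2 * j + 1)%:R ^+ m * x ^+ j) @ \oo -->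
      (1 - x) ^- m.+1 * p.[x].

(* The polynomial determined by the generating function; it exists and is
   unique, see eulerianB_polyP and eulerianB_poly_unique. *)
Definition eulerianB_poly m : {poly R} :=
  xget 0 [set p | is_eulerianB_poly m p].

Definition eulerianB m k : R := (eulerianB_poly m)`_k.

Definition calCB n t : R :=
  \sum_(0 <= k < n) eulerianB (2 * n - 1) k * (-1) ^+ k *
    \sum_(0 <= i < k.+1) (-1) ^+ i * 'C(k, i)%:R *
      (binz (2 * n - 2 * k - 1) (2 * t%:Z - 2 * i%:Z + 1))%:R.

Definition calCA n t : R :=
  \sum_(0 <= k < n) (eulerianA (2 * n) k)%:R * (-1) ^+ k *
    \sum_(0 <= i < k.+1) (-1) ^+ i * 'C(k, i)%:R *
      (binz (2 * n - 2 * k - 1) (2 * t%:Z - 2 * i%:Z + 1))%:R.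

Definition Xi n : {poly R} :=
  ((-1) ^+ n.+1 / (2 ^+ (4 * n - 2) * (2 * n - 1)`!%:R)) *:
    \sum_(0 <= t < n) calCB n t *: 'X^(2 * t).

Definition Lambda n : {poly R} :=
  (2 * (-1) ^+ n.+1 / ((2 ^+ (2 * n).+1 - 1) * (2 * n)`!%:R)) *:
    \sum_(0 <= t < n) calCA n t *: 'X^(2 * t).

(* even_poly keeps the coefficients of even index and replaces 'X^2 by 'X;
   see Xi_tildeE and Lambda_tildeE. *)
Definition Xi_tilde n : {poly R} := even_poly (Xi n).
Definition Lambda_tilde n : {poly R} := even_poly (Lambda n).

(* The measure of mass 1 / deg p at each real zero of p. The zeros are taken
   without multiplicity, so this is the empirical zero measure of p (and a
   probability measure) when p has deg p simple real zeros; see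
   zero_measureE. *)
Definition zero_measure p : {measure set (measurableTypeR R) -> \bar R} :=
  mscale (((size p).-1%:R : R)^-1)%:nng
    (msum (fun k => \d_((rootsR p)`_k : measurableTypeR R))
          (size (rootsR p))).

Definition zero_cdf p x : \bar R := zero_measure p `]-oo, x]%classic.

Definition limit_cdf x : R :=
  if x <= 0 then 0
  else if x < 1 then
    2 / pi * atan (1 / pi * ln ((1 + Num.sqrt x) / (1 - Num.sqrt x)))
  else 1.

Lemma zero_measureE p (c : R) (rs : seq R) (A : set (measurableTypeR R)) :
  c != 0 -> uniq rs -> p = c *: \prod_(r <- rs) ('X - r%:P) ->
  zero_measure p A =
  (((size rs)%:R^-1)%:E * \sum_(r <- rs) \d_(r : measurableTypeR R) A)%E.
Proof.
move=> c0 urs pE; have sp : (size p).-1 = size rs.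
  by rewrite pE size_scale// size_prod_XsubC.
have p0 : p != 0.
  by rewrite pE scaler_eq0 negb_or c0/= monic_neq0// monic_prod_XsubC.
have prs : perm_eq (rootsR p) rs.
  apply: uniq_perm => //; first exact: uniq_roots.
  move=> r; rewrite -(roots_on_rootsR p0) in_itv/= pE rootZ//.
  by rewrite root_prod_XsubC.
rewrite /zero_measure /mscale/= sp; congr (_ * _)%E.
by rewrite /msum/= -(perm_big _ prs)/= (big_nth 0) big_mkord.
Qed.

Let dif p : {poly R} := p \Po ('X + 1%:P) - p.

Let difE p (j : nat) : p.[j.+1%:R] = p.[j%:R] + (dif p).[j%:R].
Proof.
rewrite /dif hornerD hornerN horner_comp hornerD hornerX hornerC -natr1.
by rewrite addrCA subrr addr0.
Qed.

Let size_dif p d : (size p <= d.+1)%N -> (size (dif p) <= d)%N.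
Proof.
move=> sp; have [p0|p0] := eqVneq p 0.
  by rewrite p0 /dif comp_poly0 subr0 size_poly0.
have s2 : size ('X + 1%:P : {poly R}) = 2%N by rewrite size_XaddC.
have sc : size (p \Po ('X + 1%:P)) = size p by rewrite size_comp_poly2.
have lc : lead_coef (p \Po ('X + 1%:P)) = lead_coef p.
  by rewrite lead_coef_comp ?s2// lead_coefXaddC expr1n mulr1.
apply/leq_sizeP => j dj; rewrite /dif coefB.
have [jp|jp] := ltnP j (size p).
  have -> : j = (size p).-1.
    by rewrite [size p](_ : _ = j.+1)//; apply/eqP; rewrite eqn_leq jp andbT;
      exact: leq_trans sp _.
  by rewrite -{1}sc -!lead_coefE lc subrr.
by rewrite !nth_default ?sc// subrr.
Qed.

Let bounded d : forall p y, (size p <= d)%N -> 0 <= y < 1 ->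
  exists M, forall j : nat, `|p.[j%:R]| * y ^+ j <= M.
Proof.
elim: d => [|d IH] p y sp /andP[y0 y1].
  exists 0 => j; move: sp; rewrite leqn0 size_poly_eq0 => /eqP ->.
  by rewrite horner0 normr0 mul0r.
have [||M hM] := IH (dif p) y; [exact: size_dif|exact/andP|].
have M0 : 0 <= M by apply: le_trans (hM 0%N); rewrite expr0 mulr1.
exists (`|p.[0]| + M / (1 - y)) => j.
have y1' : 0 < 1 - y by rewrite subr_gt0.
elim: j => [|j IHj]; first by rewrite expr0 mulr1 lerDl divr_ge0// ltW.
rewrite difE exprS mulrCA.
apply: (@le_trans _ _ (y * (`|p.[0]| + M / (1 - y) + M))).
  rewrite ler_wpM2l//; apply: le_trans (lerD IHj (hM j)).
  by rewrite -mulrDl ler_wpM2r ?exprn_ge0// ler_normD.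
set K := M / (1 - y).
have -> : M = K * (1 - y) by rewrite divfK// gt_eqF.
have K0 : 0 <= K by rewrite divr_ge0// ltW.
have h1 : 0 <= `|p.[0]| * (1 - y) by rewrite mulr_ge0// ltW.
have h2 : 0 <= K * (1 - y) ^+ 2 by rewrite mulr_ge0// sqr_ge0.
by rewrite -subr_ge0; apply: le_trans (addr_ge0 h1 h2) _; rewrite le_eqVlt;
  apply/orP; left; apply/eqP; ring.
Qed.

Let to0 p x : `|x| < 1 -> (p.[j%:R] * x ^+ j @[j --> \oo] --> (0 : R)).
Proof.
move=> x1; pose y := (`|x| + 1) / 2.
have xy : `|x| < y by rewrite /y; lra.
have y0 : 0 < y by apply: le_lt_trans xy.
have y1 : y < 1 by rewrite /y; lra.
have [|M hM] := @bounded (size p) p y (leqnn _); first by rewrite ltW.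
apply/norm_cvg0P.
apply: (@squeeze_cvgr _ _ _ _ (fun=> 0) (fun j => M * (`|x| / y) ^+ j)).
- near=> j; rewrite normr_ge0/= normrM normrX.
  have -> : `|x| ^+ j = y ^+ j * (`|x| / y) ^+ j.
    by rewrite -exprMn mulrCA divff ?mulr1// gt_eqF.
  by rewrite mulrA ler_wpM2r// exprn_ge0// divr_ge0// ltW.
- exact: cvg_cst.
- apply: cvg_geometric; rewrite ger0_norm ?divr_ge0// ?ltW//.
  by rewrite ltr_pdivrMr// mul1r.
Unshelve. all: by end_near. Qed.

Let gf d : forall p, (size p <= d.+1)%N -> exists2 q : {poly R},
  (size q <= d.+1)%N & forall x, `|x| < 1 ->
    series (fun j => p.[j%:R] * x ^+ j) @ \oo --> (1 - x) ^- d.+1 * q.[x].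
Proof.
have step p x : `|x| < 1 -> forall l,
    series (fun j => (dif p).[j%:R] * x ^+ j) @ \oo --> l ->
    series (fun j => p.[j%:R] * x ^+ j) @ \oo -->
      (1 - x)^-1 * (p.[0] + x * l).
  move=> x1 l hl.
  have x10 : 1 - x != 0.
    by rewrite subr_eq0; apply: contraTneq x1 => <-; rewrite normr1 ltxx.
  have E N : series (fun j => p.[j%:R] * x ^+ j) N.+1 = (1 - x)^-1 *
      (p.[0] + x * series (fun j => (dif p).[j%:R] * x ^+ j) N
       - x * (p.[N%:R] * x ^+ N)).
    apply: (canRL (mulKf x10)); elim: N => [|N IH].
      by rewrite /series/= big_nat1 big_geq// expr0 !mulr1; ring.
    rewrite seriesSr mulrDr IH (seriesSr _ N) difE exprS; ring.
  rewrite -cvg_shiftS/=.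
  under eq_fun do rewrite E.
  apply: cvgMr; rewrite -[X in _ --> X]subr0 -[X in _ - X](mulr0 x).
  apply: cvgB; last exact: cvgMr (to0 p x1).
  by apply: cvgD; [exact: cvg_cst|exact: cvgMr].
elim: d => [|d IH] p sp.
  exists (p.[0])%:P => [|x x1]; first by rewrite size_polyC; case: (_ != 0).
  have d0 : dif p = 0 by apply/eqP; rewrite -size_poly_eq0 -leqn0 size_dif.
  have := @step p x x1 0; rewrite mulr0 addr0 hornerC expr1; apply.
  rewrite d0 (_ : series _ = fun=> 0); first exact: cvg_cst.
  by apply/funext => N; rewrite /series/= big1// => i _; rewrite horner0 mul0r.
have [q sq hq] := IH _ (size_dif sp).
exists ((p.[0])%:P * (1 - 'X) ^+ d.+1 + 'X * q) => [|x x1].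
  have s1 : size (1 - 'X : {poly R}) = 2%N by rewrite -opprB size_polyN -polyC1 size_XsubC.
  apply: (leq_trans (size_polyD _ _)); rewrite geq_max; apply/andP; split.
    rewrite mul_polyC (leq_trans (size_scale_leq _ _))//.
    by apply: (leq_trans (size_poly_exp_leq _ _)); rewrite s1 mul1n.
  by apply: (leq_trans (size_polyMleq _ _)); rewrite size_polyX.
have x10 : 1 - x != 0.
  by rewrite subr_eq0; apply: contraTneq x1 => <-; rewrite normr1 ltxx.
rewrite !hornerE exprS invfM.
have x1d : (1 - x) ^+ d.+1 != 0 by rewrite expf_neq0.
rewrite (_ : _ * _ * _ = (1 - x)^-1 * (p.[0] + x * ((1 - x) ^- d.+1 * q.[x]))).
  exact: step (hq x x1).
set z := _ ^+ d.+1 in x1d *.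
by field; rewrite x10 x1d.
Qed.

Lemma eulerianB_polyP m : is_eulerianB_poly m (eulerianB_poly m).
Proof.
rewrite /eulerianB_poly.
apply: (@xgetPex _ 0 [set p | is_eulerianB_poly m p]); rewrite /mkset.
have [|q sq hq] := @gf m ((2 *: 'X + 1) ^+ m).
  apply: (leq_trans (size_poly_exp_leq _ _)); rewrite ltnS.
  rewrite -[leqRHS]mul1n leq_mul2r; apply/orP; right.
  have : (size (2 *: 'X + 1 : {poly R})%R <= 2)%N; last by case: size => [|[]].
  apply: (leq_trans (size_polyD _ _)); rewrite size_poly1 geq_max andbT.
  by rewrite (leq_trans (size_scale_leq _ _))// size_polyX.
exists q; split=> // x x1.
rewrite (_ : (fun j => _) = (fun j => ((2 *: 'X + 1) ^+ m).[j%:R] * x ^+ j)).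
  exact: hq.
by apply/funext => j; rewrite !hornerE natrD natrM.
Qed.

Lemma eulerianB_poly_unique m p : is_eulerianB_poly m p -> p = eulerianB_poly m.
Proof.
move=> [_ hp]; have [_ hq] := eulerianB_polyP m.
apply/eqP; rewrite -subr_eq0; apply/negPn/negP => pq0.
pose rs := [seq (i.+2%:R : R)^-1 | i <- iota 0 (size (p - eulerianB_poly m))].
suff : (size rs < size (p - eulerianB_poly m)%R)%N.
  by rewrite size_map size_iota ltnn.
apply: max_poly_roots => //.
  apply/allP => _ /mapP[i _ ->]; set x := _^-1.
  have x1 : `|x| < 1.
    by rewrite ger0_norm ?invr_ge0// invf_lt1// ltr1n.
  have x10 : (1 - x) ^- m.+1 != 0.
    rewrite invr_eq0 expf_neq0// subr_eq0.
    by apply: contraTneq x1 => <-; rewrite normr1 ltxx.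
  rewrite rootE hornerD hornerN subr_eq0; apply/eqP.
  by apply: (mulfI x10); exact: (cvg_unique _ (hp x x1) (hq x x1)).
rewrite map_inj_uniq ?iota_uniq// => i j /invr_inj /eqP.
by rewrite eqr_nat => /eqP[].
Qed.

Let even_polyZsum (c : R) (a : nat -> R) n :
  even_poly (c *: \sum_(0 <= t < n) a t *: 'X^(2 * t)) =
  c *: \sum_(0 <= t < n) a t *: 'X^t.
Proof.
rewrite even_polyZ; congr (_ *: _); rewrite raddf_sum/=; apply: eq_bigr => t _.
rewrite even_polyZ; congr (_ *: _); apply/polyP => i.
by rewrite coef_even_poly !coefXn mul2n (inj_eq double_inj).
Qed.

Lemma Xi_tildeE n : Xi_tilde n =
  ((-1) ^+ n.+1 / (2 ^+ (4 * n - 2) * (2 * n - 1)`!%:R)) *: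
    \sum_(0 <= t < n) calCB n t *: 'X^t.
Proof. exact: even_polyZsum. Qed.

Lemma Lambda_tildeE n : Lambda_tilde n =
  (2 * (-1) ^+ n.+1 / ((2 ^+ (2 * n).+1 - 1) * (2 * n)`!%:R)) *:
    \sum_(0 <= t < n) calCA n t *: 'X^t.
Proof. exact: even_polyZsum. Qed.

End Defs.

(* Main.v *)
Require Import Defs.
From mathcomp Require Import all_boot all_order all_algebra all_fingroup.
From mathcomp Require Import all_classical all_reals all_analysis.
From mathcomp Require Import complex polyrcf.
From mathcomp Require Import zify ring lra.

Set Implicit Arguments.
Unset Strict Implicit.
Unset Printing Implicit Defensive.

Import Order.TTheory GRing.Theory Num.Theory.
Import numFieldNormedType.Exports.
Import ComplexField.Normc.

Local Open Scope classical_set_scope.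
Local Open Scope ring_scope.

(** The Eulerian numbers of both types are symmetric, so each of the two central
    sums unfolds into a complete Eulerian polynomial: with
    [u = (1 - x) / (1 + x)], the value [x * Xi_n(x)] is a nonzero constant
    times [(1 + x) ^ (2n - 1)] times the type B polynomial of index [2n - 1] at
    [- u], and [x * Lambda_n(x)] is obtained in the same way from the type A
    polynomial of index [2n] ([central_sum_palindromic], [Xi_tilde_horner],
    [Lambda_tilde_horner]).  So the zeros in question are, up to a change of
    variable, the zeros of Eulerian polynomials.

    Eulerian polynomials are numerators of polylogarithms of negative order:
    [Li_(-m)(z) = sum_j j^m z^j = E_m(z) / (1 - z)^(m+1)], where [E_m(z)] is
    [z] times the type A polynomial, while [z B_m(z^2)], with [B_m] the type B
    polynomial, is the odd part of [E_m(z) * (1 + z)^(m+1)]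
    ([polylog_num_even_odd]).  Put
    [u = exp(- L)].  The type A value at [- u] is read off at [w = - L + i pi]
    and the type B value at [w = (- L + i pi) / 2] ([polylog_at_pi],
    [Im_polylog_at_half_pi]).  The function [Li_(-m)(e^w)] is the sum of
    [m! / (2 pi i k - w)^(m+1)] over all integers [k].  This expansion comes from
    the duplication formula
    [2^(m+1) Li_(-m)(z^2) = Li_(-m)(z) + Li_(-m)(- z)]: iterated [N] times it
    writes the value at [w] as a sum over the points [v = (w + 2 pi i k) / 2^N]
    ([polylog_centered_multisection]).  They lie in the strip [|Im v| <= pi],
    where [Li_(-m)(e^v)] differs from its pole part [m! / (- v)^(m+1)] by
    [O(1 / |v|^m)] only ([polylog_pole]), and for [m >= 2] the total error
    vanishes as [N] grows.

    For large [m] the poles nearest to [w] outweigh all the others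
    ([polylog_two_poles]), uniformly for [w] bounded.  Writing [L = pi * tan t],
    the relevant part of their contribution is [sin ((m + 1) t)] times a positive
    factor and a sign that depends on [m] only.  Hence the polynomials alternate
    in sign at the points with [(m + 1) t = pi / 2 + j pi]
    ([Xi_tilde_sign], [Lambda_tilde_sign]), and there is a zero between any two
    consecutive ones.  The limit [F] is made so that the point of angle [t] is
    the quantile of order [2 t / pi] ([limit_cdf_angle]); since [m + 1] is [2n]
    or [2n + 1], about [n F(x)] zeros are thus found up to [x] and about
    [n (1 - F(x))] beyond.  The degree is at most [n - 1], so both counts are
    asymptotically sharp ([zero_cdf_bounds], [zero_cdf_close]). *)

(** * Eulerian polynomials and numerators of polylogarithms *)

(** Both types at once: [eulerian_poly F 2 m] is the type B Eulerian polynomial of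
    index [m], and [eulerian_poly F 1 m] the type A one of index [m + 1]. *)
Fixpoint eulerian_poly (F : comNzRingType) (c d : nat) : {poly F} :=
  if d is d'.+1 then
    (1 + (c * d' + 1)%:R * 'X) * eulerian_poly F c d' +
      c%:R * ('X * (1 - 'X) * (eulerian_poly F c d')^`())
  else 1.

(** The numerator of [Li_(-m)]: applying [z d/dz] to [E_m(z) / (1 - z)^(m+1)]
    gives the recursion. *)
Fixpoint polylog_num (F : comNzRingType) (m : nat) : {poly F} :=
  if m is m'.+1 then
    'X * ((1 - 'X) * (polylog_num F m')^`() + m'.+1%:R * polylog_num F m')
  else 'X.

Lemma eulerian_polyS (F : comNzRingType) c d : eulerian_poly F c d.+1 =
  (1 + (c * d + 1)%:R * 'X) * eulerian_poly F c d +
    c%:R * ('X * (1 - 'X) * (eulerian_poly F c d)^`()).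
Proof. by []. Qed.

Lemma polylog_numS (F : comNzRingType) m : polylog_num F m.+1 =
  'X * ((1 - 'X) * (polylog_num F m)^`() + m.+1%:R * polylog_num F m).
Proof. by []. Qed.

Lemma map_eulerian_poly (F K : comNzRingType) (f : {rmorphism F -> K}) c d :
  map_poly f (eulerian_poly F c d) = eulerian_poly K c d.
Proof.
elim: d => [|d IH]; rewrite ?eulerian_polyS /= ?rmorph1//.
rewrite !(rmorphB, rmorphD, rmorphM, rmorph1)/= !rmorph_nat map_polyX.
by rewrite -deriv_map IH.
Qed.

Lemma map_polylog_num (F K : comNzRingType) (f : {rmorphism F -> K}) m :
  map_poly f (polylog_num F m) = polylog_num K m.
Proof.
elim: m => [|m IH]; rewrite [polylog_num _ _]/= ?map_polyX//.
rewrite rmorphM/= map_polyX rmorphD/= !rmorphM/= rmorphB/= rmorph1 map_polyX.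
by rewrite rmorph_nat -deriv_map IH.
Qed.

Lemma polylog_numE (F : comNzRingType) m : polylog_num F m.+1 = 'X * eulerian_poly F 1 m.
Proof.
elim: m => [|m IH]; first by rewrite /= derivX; ring.
by rewrite [polylog_num _ _]/= -/(polylog_num F m.+1) IH /= derivM derivX; ring.
Qed.

(** The value at [1] is the leading coefficient [m!] of the pole of [Li_(-m)(e^v)]
    at [v = 0]. *)
Lemma polylog_num_at1 (F : comNzRingType) m : (polylog_num F m).[1] = m`!%:R.
Proof.
elim: m => [|m IH] /=; first by rewrite hornerX.
by rewrite !hornerE -polyC_natr hornerC IH subrr mul0r add0r factS natrM.
Qed.

(** After division by [(1 - z^2)^(m+1)], this splits [sum_j j^m z^j] into the
    terms with [j] even, which are [2^m Li_(-m)(z^2)], and those with [j] odd,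
    whose generating function is of type B.  Both sides satisfy the same
    first-order recursion in [m]. *)
Lemma polylog_num_even_odd (F : comNzRingType) m :
  polylog_num F m * (1 + 'X) ^+ m.+1 =
  2 ^+ m * (polylog_num F m \Po 'X^2) + 'X * (eulerian_poly F 2 m \Po 'X^2).
Proof.
have XX : ('X^2 : {poly F})^`() = 2 * 'X by rewrite derivXn/= mulr_natl.
have natC n : (n%:R \Po 'X^2 : {poly F}) = n%:R by rewrite rmorph_nat.
have dnat n : (n%:R : {poly F})^`() = 0 by rewrite -polyC_natr derivC.
elim: m => [|m IH].
  by rewrite /= comp_polyX comp_polyC; ring.
have rec (L := polylog_num F m * (1 + 'X) ^+ m.+1) :
    polylog_num F m.+1 * (1 + 'X) ^+ m.+2 =
    'X * (1 - 'X^2) * L^`() + 2 * m.+1%:R * 'X^2 * L.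
  have d1 : (1 + 'X : {poly F})^`() = 1 by rewrite derivD (dnat 1) derivX add0r.
  have -> : L^`() = (polylog_num F m)^`() * (1 + 'X) ^+ m.+1 +
      polylog_num F m * (m.+1%:R * (1 + 'X) ^+ m).
    by rewrite /L derivM deriv_exp d1 mul1r/= mulr_natl.
  rewrite /L [polylog_num _ m.+1]/= !exprS; move: (_ ^+ m) => e; ring.
have d2 : (2 ^+ m : {poly F})^`() = 0 by rewrite -natrX dnat.
have dcomp (p : {poly F}) : (p \Po 'X^2)^`() = (p^`() \Po 'X^2) * (2 * 'X).
  by rewrite deriv_comp XX.
rewrite rec IH derivD !derivM d2 derivX !dcomp polylog_numS eulerian_polyS.
rewrite !(comp_polyB, comp_polyD, comp_polyM, comp_polyX, natC).
rewrite -polyC1 !comp_polyC polyC1 [in RHS]exprS.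
by move: (2 ^+ m) (_ \Po _) (_ \Po _) (_ \Po _) (_ \Po _) => a b c d e; ring.
Qed.

Lemma horner_polylog_num_even_odd (F : comNzRingType) m (y : F) :
  (polylog_num F m).[y] * (1 + y) ^+ m.+1 =
  2 ^+ m * (polylog_num F m).[y ^+ 2] + y * (eulerian_poly F 2 m).[y ^+ 2].
Proof.
have /(congr1 (horner_eval y)) := polylog_num_even_odd F m.
rewrite !(rmorphD, rmorphM, rmorphXn, rmorph1)/= /horner_eval.
by rewrite !horner_comp hornerX hornerXn.
Qed.

Lemma coef_eulerian_polyS (F : comNzRingType) c d k :
  (eulerian_poly F c d.+1)`_k = (c * k + 1)%:R * (eulerian_poly F c d)`_k +
    (c%:R * (d%:R - k%:R + 1) + 1) * ('X * eulerian_poly F c d)`_k.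
Proof.
have -> : eulerian_poly F c d.+1 =
    eulerian_poly F c d + ('X * eulerian_poly F c d) *+ (c * d + 1) +
    ('X * (eulerian_poly F c d)^`()) *+ c - ('X * ('X * (eulerian_poly F c d)^`())) *+ c.
  rewrite eulerian_polyS -(mulr_natl ('X * eulerian_poly F c d)).
  move: (eulerian_poly F c d) (_^`()) => p q.
  by rewrite -(mulr_natl ('X * q)) -(mulr_natl ('X * _)); ring.
rewrite !(coefD, coefB, coefN, coefMn, coefXM).
case: k => [|[|k]] /=; rewrite ?coef_deriv; ring.
Qed.

Lemma size_eulerian_poly (F : comNzRingType) c d : (size (eulerian_poly F c d) <= d.+1)%N.
Proof.
elim: d => [|d IH]; first by rewrite size_poly1.
apply/leq_sizeP => -[//|j] dj; rewrite coef_eulerian_polyS coefXM/=.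
by rewrite !nth_default ?mulr0 ?addr0// (leq_trans IH)// ltnW.
Qed.

(** The recursion exchanges its two terms when [k] is replaced by [d + 1 - k]. *)
Lemma eulerian_poly_palindromic (F : comNzRingType) c d k : (k <= d)%N ->
  (eulerian_poly F c d)`_(d - k) = (eulerian_poly F c d)`_k.
Proof.
elim: d k => [[]//|d IH k]; have gd : (eulerian_poly F c d)`_d.+1 = 0.
  by rewrite nth_default// size_eulerian_poly.
have ends : (eulerian_poly F c d.+1)`_d.+1 = (eulerian_poly F c d.+1)`_0.
  rewrite !coef_eulerian_polyS !coefXM/= gd -{2}(subn0 d) -(IH 0%N)// subn0 natrD; ring.
rewrite leq_eqVlt => /predU1P[->|]; first by rewrite subnn ends.
case: k => [_|k]; first by rewrite subn0 ends.
rewrite !ltnS subSS => kd; rewrite -(subnSK kd) !coef_eulerian_polyS !coefXM/= subnSK//.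
rewrite (IH k)// ?(ltnW kd)// (IH k.+1)//.
have -> : (d%:R : F) = (d - k)%:R + k%:R by rewrite -natrD subnK// ltnW.
by rewrite !natrD !natrM; ring.
Qed.

(** * The central sums as values of Eulerian polynomials *)

Lemma sum_shift0 (F : nmodType) (f : nat -> F) a b :
  \sum_(a <= i < b) f i = \sum_(0 <= i < b - a) f (i + a)%N.
Proof. by rewrite -{1}(add0n a) big_addn. Qed.

Lemma sum_even_odd (F : nmodType) (f : nat -> F) n :
  \sum_(0 <= j < 2 * n) f j =
  \sum_(0 <= s < n) (f (2 * s)%N + f (2 * s).+1).
Proof.
elim: n => [|n IH]; first by rewrite !big_geq.
by rewrite mulnS add2n !big_nat_recr//= IH addrA.
Qed.

Lemma odd_binomial_sum (F : comNzRingType) (x : F) m s : (m <= 2 * s)%N ->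
  2 * \sum_(0 <= j < s) 'C(m, (2 * j).+1)%:R * x ^+ (2 * j).+1 =
  (1 + x) ^+ m - (1 - x) ^+ m.
Proof.
move=> ms; rewrite !exprDn -sumrB.
rewrite -(big_mkord xpredT
  (fun i => 1 ^+ (m - i) * x ^+ i *+ 'C(m, i) -
            1 ^+ (m - i) * (- x) ^+ i *+ 'C(m, i))).
have -> : \sum_(0 <= i < m.+1) (1 ^+ (m - i) * x ^+ i *+ 'C(m, i) -
            1 ^+ (m - i) * (- x) ^+ i *+ 'C(m, i)) =
          \sum_(0 <= i < 2 * s.+1)
            'C(m, i)%:R * (x ^+ i - (- x) ^+ i).
  rewrite [RHS](@big_cat_nat _ _ _ m.+1)//=; last lia.
  rewrite [X in _ = _ + X]big_nat_cond [X in _ = _ + X]big1 ?addr0.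
    by apply: eq_bigr => i _; rewrite !expr1n -mulr_natl -[X in _ - X]mulr_natl; ring.
  by move=> i /andP[/andP[mi _] _]; rewrite bin_small// mul0r.
rewrite sum_even_odd big_nat_recr//= (@bin_small m (2 * s).+1)//.
rewrite (exprM (- x)) sqrrN -exprM subrr mulr0 mul0r !addr0.
rewrite mulr_sumr; apply: eq_bigr => j _.
by rewrite !exprS !exprM sqrrN; ring.
Qed.

(** The sum over [t] of a convolution of binomial coefficients is the product of
    [(1 - x^2)^k] with the odd part of [(1 + x)^(2n - 2k - 1)]. *)
Lemma binz_sum (F : comNzRingType) (x : F) n k : (k < n)%N ->
  2 * x * \sum_(0 <= t < n)
    (\sum_(0 <= i < k.+1) (-1) ^+ i * 'C(k, i)%:R *
      (binz (2 * n - 2 * k - 1) (2 * t%:Z - 2 * i%:Z + 1))%:R) * x ^+ (2 * t) =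
  (1 - x ^+ 2) ^+ k *
    ((1 + x) ^+ (2 * n - 2 * k - 1) - (1 - x) ^+ (2 * n - 2 * k - 1)).
Proof.
move=> kn; set M := (2 * n - 2 * k - 1)%N.
under eq_bigr do rewrite mulr_suml.
rewrite exchange_big_nat/= mulr_sumr.
rewrite exprBn -(big_mkord xpredT (fun i => (-1) ^+ i * 1 ^+ (k - i) *
   (x ^+ 2) ^+ i *+ 'C(k, i))) mulr_suml.
rewrite [LHS]big_nat_cond [RHS]big_nat_cond.
apply: eq_bigr => i /andP[/andP[_ ik] _].
rewrite (@big_cat_nat _ _ _ i)//=; last lia.
rewrite [X in X + _]big_nat_cond [X in X + _]big1 ?add0r; last first.
  move=> t /andP[/andP[_ ti] _].
  by have -> : 2 * t%:Z - 2 * i%:Z + 1 = Negz (2 * (i - t) - 2); [lia|rewrite /= mulr0 mul0r].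
rewrite sum_shift0.
rewrite -(@odd_binomial_sum _ _ _ (n - i)); last by rewrite /M; lia.
rewrite !mulr_sumr; apply: eq_bigr => t _.
have -> : 2 * (t + i)%:Z - 2 * i%:Z + 1 = Posz (2 * t).+1 by lia.
by rewrite /binz expr1n mulnDr exprD (exprM x 2 i) (exprS x (2 * t)) -mulr_natl; ring.
Qed.

(** The two halves of the odd part in [binz_sum] are the terms of index [k] and
    [2n - 1 - k] of a single sum, because [g] is symmetric and [2n - 1] is
    odd. *)
Lemma central_sum_palindromic (F : comNzRingType) (g : nat -> F) (x : F) n :
  (0 < n)%N -> (forall k, (k < 2 * n)%N -> g (2 * n - 1 - k)%N = g k) ->
  2 * x * \sum_(0 <= t < n)
    (\sum_(0 <= k < n) g k * (-1) ^+ k *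
      \sum_(0 <= i < k.+1) (-1) ^+ i * 'C(k, i)%:R *
      (binz (2 * n - 2 * k - 1) (2 * t%:Z - 2 * i%:Z + 1))%:R) * x ^+ (2 * t) =
  \sum_(0 <= k < 2 * n) g k * (x - 1) ^+ k * (1 + x) ^+ (2 * n - 1 - k).
Proof.
move=> n0 sym.
under eq_bigr do rewrite mulr_suml.
rewrite exchange_big_nat/= mulr_sumr.
rewrite [RHS](@big_cat_nat _ _ _ n)//=; last lia.
rewrite [X in _ = _ + X]big_nat_rev/= (sum_shift0 _ n).
have -> : (2 * n - n = n)%N by lia.
rewrite -big_split/= [LHS]big_nat_cond [RHS]big_nat_cond.
apply: eq_bigr => k /andP[/andP[_ kn] _].
under [X in _ * X = _]eq_bigr do rewrite -mulrA.
rewrite -mulr_sumr mulrCA binz_sum//.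
have -> : (n + 2 * n - (k + n).+1 = 2 * n - 1 - k)%N by lia.
rewrite sym; last lia.
have -> : (2 * n - 1 - (2 * n - 1 - k) = k)%N by lia.
have -> : (2 * n - 1 - k = (2 * n - 2 * k - 1) + k)%N by lia.
have -> : (2 * n - 2 * k - 1 = (2 * (n - k.+1)).+1)%N by lia.
set M := (n - k.+1)%N.
have -> : 1 - x ^+ 2 = (1 - x) * (1 + x) by ring.
have x1 j : (x - 1) ^+ j = (-1) ^+ j * (1 - x) ^+ j.
  by rewrite -exprMn; congr (_ ^+ _); ring.
have sM : (-1) ^+ (2 * M).+1 = -1 :> F.
  by rewrite -signr_odd /= mul2n odd_double expr1.
by rewrite (exprD (x - 1)) (exprD (1 + x)) !x1 sM exprMn; ring.
Qed.

(** * Descents of permutations *)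

(** A count over natural numbers, easier to cut and shift than the set of
    positions. *)
Lemma card_descents n (s : 'S_n.+1) : #|descents s| =
  (\sum_(0 <= p < n) (s (inord p.+1) < s (inord p)))%N.
Proof.
have -> : #|descents s| = (\sum_(i < n.+1) (i \in descents s))%N.
  by rewrite -sum1_card big_mkcond; apply: eq_bigr => i _; case: (_ \in _).
rewrite big_ord_recr/= inE (_ : [exists _, _] = false) ?addn0; last first.
  by apply/existsP => -[j /andP[/eqP jn _]]; have := ltn_ord j; rewrite jn ltnn.
rewrite big_mkord; apply: eq_bigr => i _; congr (nat_of_bool _).
have -> : widen_ord (leqnSn n) i = inord i.
  by apply: val_inj; rewrite /= inordK// ltnW// ltnS.
rewrite inE; apply/existsP/idP => [[j /andP[/eqP ji]]|si].
  suff -> : j = inord i.+1 by [].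
  by apply: val_inj; rewrite /= ji !inordK ?ltnS// ltnW// ltnS.
by exists (inord i.+1); rewrite si !inordK ?eqxx// ?ltnS// ltnW// ltnS.
Qed.

(** [lift_perm i ord_max s] is the word of [s] with the largest letter inserted
    at position [i]. *)
Lemma insert_max_word n (i : 'I_n.+2) (s : 'S_n.+1) p : (p < n.+2)%N ->
  lift_perm i ord_max s (inord p) =
  (if (p < i)%N then nat_of_ord (s (inord p))
   else if p == i then n.+1 else s (inord p.-1)) :> nat.
Proof.
move=> pn; have [pi|pi|pi] := ltngtP p i.
- have -> : inord p = lift i (inord p : 'I_n.+1).
    apply: val_inj; rewrite /= /bump !inordK//; first by rewrite leqNgt pi.
    by rewrite (leq_trans pi)// -ltnS.
  by rewrite lift_perm_lift/= /bump leqNgt ltn_ord.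
- have -> : inord p = lift i (inord p.-1 : 'I_n.+1).
    apply: val_inj; rewrite /= /bump !inordK//; first by lia.
    by lia.
  by rewrite lift_perm_lift/= /bump leqNgt ltn_ord.
- by rewrite (_ : inord p = i) ?lift_perm_id//; apply: val_inj; rewrite /= inordK.
Qed.

(** The inserted maximum is followed by a descent unless it comes last, and it
    destroys the descent, if any, across the gap where it is inserted. *)
Lemma descents_insert_max (w w' : nat -> nat) n i : (i <= n.+1)%N ->
  (forall p, w p <= n)%N ->
  (forall p, (p < n.+2)%N -> w' p =
     if (p < i)%N then w p else if p == i then n.+1 else w p.-1) ->
  (\sum_(0 <= p < n.+1) (w' p.+1 < w' p) +
     [&& 0 < i, i <= n & w i < w i.-1] =
   \sum_(0 <= p < n) (w p.+1 < w p) + (i <= n))%N.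
Proof.
move=> ile wn w'E; case: i ile w'E => [_|i ile] w'E /=.
  rewrite big_nat_recl//= !w'E//= ltnS wn addn0 addnC; congr addn.
  rewrite big_nat_cond [RHS]big_nat_cond.
  by apply: eq_bigr => p /andP[/andP[_ pn] _]; rewrite !w'E//= ltnS (leq_trans pn).
(* Cut at the pair of positions that ends with the maximum. *)
rewrite (big_cat_nat (n := i))//=; last lia.
rewrite (big_ltn (m := i))//=.
rewrite !w'E ?ltnn ?eqxx ?leqnn//; last lia.
have -> : (n.+1 < w i)%N = false.
  by apply/negbTE; rewrite -leqNgt (leq_trans (wn i)).
rewrite /= add0n.
have E1 : (\sum_(0 <= p < i) (w' p.+1 < w' p) =
    \sum_(0 <= p < i) (w p.+1 < w p))%N.
  rewrite big_nat_cond [RHS]big_nat_cond; apply: eq_bigr => p /andP[/andP[_ pi] _].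
  by rewrite !w'E; [rewrite !ltnS pi (ltnW pi)|lia|lia].
rewrite E1; move: ile; rewrite ltnS leq_eqVlt => /predU1P[->|ilt].
  by rewrite ltnn (@big_geq _ _ _ n.+1 n.+1)//= !addn0.
rewrite ilt/= (big_ltn (m := i.+1))//= [in RHS](big_cat_nat (n := i))//=; last exact: ltnW.
rewrite [in RHS](big_ltn (m := i))//=.
have -> : w' i.+1 = n.+1 by rewrite w'E ?ltnn ?eqxx//; lia.
have -> : w' i.+2 = w i.+1.
  by rewrite w'E; [rewrite ifF ?ifF//; lia|lia].
rewrite ltnS wn -{1}(addn1 i.+1) big_addn subn1/=.
have -> : (\sum_(i.+1 <= p < n) (w' (p + 1).+1 < w' (p + 1)) =
   \sum_(i.+1 <= p < n) (w p.+1 < w p))%N.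
  rewrite big_nat_cond [RHS]big_nat_cond; apply: eq_bigr => p /andP[/andP[ip pn] _].
  by rewrite !w'E; [|lia|lia]; do ![rewrite ifF; last lia]; rewrite addn1.
by lia.
Qed.

Lemma insert_max_bij n :
  bijective (fun q : 'I_n.+2 * 'S_n.+1 => lift_perm q.1 ord_max q.2).
Proof.
apply: inj_card_bij; last first.
  by rewrite card_prod !card_Sn card_ord factS.
move=> [i s] [i' s'] /= E.
have ii' : i = i'.
  by apply: (@perm_inj _ (lift_perm i ord_max s)); rewrite {2}E !lift_perm_id.
rewrite -ii' in E *; congr (_, _); apply/permP => k.
have := congr1 (fun t : 'S_n.+2 => t (lift i k)) E.
by rewrite /= !lift_perm_lift => /lift_inj.
Qed.

(** Each permutation of size [n + 2] arises from exactly one insertion of the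
    maximum.  Of the [n + 2] insertions into a word with [d] descents, [d + 1]
    keep the number of descents and the others increase it by one, which is the
    recursion of [eulerian_poly]. *)
Lemma sum_descents_eulerian_poly (F : comNzRingType) n :
  \sum_(s : 'S_n.+1) 'X^#|descents s| = eulerian_poly F 1 n.
Proof.
elim: n => [|n IH].
  have p1 (s : 'S_1) : 'X^#|descents s| = 1 :> {poly F}.
    by rewrite card_descents big_geq.
  rewrite (eq_bigr _ (fun s _ => p1 s)) sumr_const.
  by rewrite (_ : #|_| = 1%N) // -[RHS](card_Sn 1)//; apply: eq_card => s; rewrite !inE.
rewrite (reindex _ (onW_bij _ (insert_max_bij n)))/=.
rewrite -(pair_big xpredT xpredT
  (fun i s => 'X^#|descents (lift_perm i ord_max s)| : {poly F}))/=.
rewrite exchange_big/= -IH raddf_sum !mulr_sumr -big_split/=.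
apply: eq_bigr => s _.
set d := #|descents s|.
pose w p := nat_of_ord (s (inord p)).
have dE : d = (\sum_(0 <= p < n) (w p.+1 < w p))%N by exact: card_descents.
pose c i := [&& (0 < i)%N, (i <= n)%N & (w i < w i.-1)%N].
have key (i : 'I_n.+2) :
    (#|descents (lift_perm i ord_max s)| + c i = d + (i <= n))%N.
  rewrite card_descents dE.
  apply: (@descents_insert_max w
    (fun p => nat_of_ord (lift_perm i ord_max s (inord p)))).
  - by rewrite -ltnS ltn_ord.
  - by move=> p; rewrite -ltnS ltn_ord.
  - by move=> p pn; rewrite insert_max_word.
have csum : (\sum_(0 <= i < n.+1) c i = d)%N.
  rewrite big_nat_recl//= dE big_nat_cond [RHS]big_nat_cond.
  by apply: eq_bigr => p /andP[/andP[_ pn] _]; rewrite /c/= pn.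
pose e i : {poly F} := (c i)%:R.
have terms (i : 'I_n.+1) :
    'X^#|descents (lift_perm (widen_ord (leqnSn _) i) ord_max s)| =
    e i * 'X^d + (1 - e i) * 'X^(d.+1).
  have := key (widen_ord (leqnSn _) i); rewrite /e /= -ltnS ltn_ord.
  case: (c i) => /= E.
    by rewrite subrr mul0r addr0 mul1r; congr (_ ^+ _); lia.
  by rewrite mul0r add0r subr0 mul1r; congr (_ ^+ _); lia.
rewrite big_ord_recr/= (eq_bigr _ (fun i _ => terms i)) big_split/=.
rewrite -!mulr_suml sumrB sumr_const card_ord.
rewrite -(big_mkord xpredT e) -natr_sum csum.
have -> : #|descents (lift_perm ord_max ord_max s)| = d.
  by have := key ord_max; rewrite /c /= ltnn/= !addn0.
rewrite derivXn exprS.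
case: (d) => [|j]; first by rewrite mulr0n; ring.
by rewrite -pred_Sn exprS; ring.
Qed.

Lemma eulerianA_eulerian_poly (F : comNzRingType) n k :
  (eulerianA n.+1 k)%:R = (eulerian_poly F 1 n)`_k.
Proof.
rewrite -sum_descents_eulerian_poly coef_sum /eulerianA -sum1_card natr_sum big_mkcond.
by apply: eq_bigr => s _; rewrite coefXn eq_sym unfold_in /in_set asboolb; case: (_ == _).
Qed.

(** * The generating function of type B *)

(** Identifies the derivative of a function known only near the point. *)
Lemma derive_near0 (R : realType) (h : R -> R) (x d : R) :
  (\forall y \near x, h y = 0) -> is_derive x (1 : R) h d -> d = 0.
Proof.
move=> h0 [hd <-]; rewrite /derive; apply: cvg_lim => //.
apply: (@cvg_trans _ ((fun=> (0 : R)) @ (0 : R)^')); last exact: cvg_cst.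
apply: near_eq_cvg.
have hx : h x = 0 by apply: nbhs_singleton h0.
have : \forall t \near (0 : R), h (t + x) = 0.
  have /(_ _ h0) : (fun t : R => t + x) @ (0 : R) --> x.
    by rewrite -[X in _ --> X]add0r; apply: cvgD; [exact: cvg_id|exact: cvg_cst].
  by [].
move=> ht; near=> t; rewrite /= hx subr0.
have -> : h (t *: 1 + x) = 0.
  by rewrite [t *: _]mulr1; near: t; apply: nbhs_dnbhs.
by rewrite scaler0.
Unshelve. all: by end_near. Qed.

(** The powers of [2 j + 1] span the polynomials in [j], so the convergence of the
    series that define the type B polynomials is enough. *)
Lemma is_cvg_pseries_poly (R : realType) (p : {poly R}) (x : R) : `|x| < 1 ->
  cvgn (pseries (fun j => p.[j%:R]) x).
Proof.
move=> x1.
(* This gives [q (2 j + 1) = p j]. *)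
pose q := p \Po (2^-1 *: ('X - 1%:P)).
have pq j : p.[j%:R] = \sum_(i < size q) q`_i * (2 * j + 1)%:R ^+ i.
  rewrite -horner_coef horner_comp hornerZ hornerXsubC natrD natrM; congr _.[_].
  by rewrite addrK mulKf.
rewrite (_ : pseries _ x = \sum_(i < size q)
    (q`_i *: series (fun j => (2 * j + 1)%:R ^+ i * x ^+ j))); last first.
  apply/funext => N; rewrite fct_sumE /pseries /series /= /series /=.
  under eq_bigr do rewrite pq mulr_suml.
  rewrite exchange_big/=; apply: eq_bigr => i _.
  rewrite [RHS]mulr_sumr; by apply: eq_bigr => j _; rewrite mulrA.
elim/big_ind: _ => [|u v cu cv|i _]; [exact: is_cvg_cst|exact: is_cvgD|apply: is_cvgZr].
exact: cvgP ((eulerianB_polyP R i).2 x x1).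
Qed.

(** Termwise, [(2 j + 1)^(m+1) x^j] is obtained from [(2 j + 1)^m x^j] by applying
    [1 + 2 x d/dx].  Applied to the closed form, this operator gives the
    recursion of [eulerian_poly]. *)
Lemma eulerianB_eulerian_poly (R : realType) m : eulerianB_poly R m = eulerian_poly R 2 m.
Proof.
apply/esym/eulerianB_poly_unique; split; first exact: size_eulerian_poly.
elim: m => [|m IH] x x1.
  rewrite /= hornerC expr1 mulr1 -[_^-1]mul1r.
  rewrite (_ : series _ = series (geometric 1 x)); first exact: cvg_geometric_series.
  by congr series; apply/funext => j; rewrite /= expr0.
pose c j : R := ((2 *: 'X + 1) ^+ m).[j%:R].
have cE j : c j = (2 * j + 1)%:R ^+ m by rewrite /c !hornerE natrD natrM.
have dpoly (p : {poly R}) : pseries_diffs (fun j => p.[j%:R]) =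
    fun j => (('X + 1) * (p \Po ('X + 1))).[j%:R].
  apply/funext => j; rewrite /pseries_diffs hornerM horner_comp !hornerE.
  by rewrite -natr1.
have lc y : `|y| < 1 -> limn (pseries c y) = (1 - y) ^- m.+1 * (eulerian_poly R 2 m).[y].
  move=> y1; apply: cvg_lim => //; rewrite (_ : pseries c y =
    series (fun j => (2 * j + 1)%:R ^+ m * y ^+ j)); first exact: IH.
  by rewrite /pseries; congr (series _); apply/funext => j; rewrite /= cE.
(* Termwise differentiation at [x] needs a larger radius of convergence. *)
pose K := (1 + `|x|) / 2.
have K1 : `|K| < 1 by rewrite ger0_norm /K; have := normr_ge0 x; lra.
have xK : `|x| < `|K| by rewrite (ger0_norm (_ : 0 <= K)) /K; have := normr_ge0 x; lra.
have dA : is_derive x (1 : R) (fun y => limn (pseries c y))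
    (limn (pseries (pseries_diffs c) x)).
  apply: (@pseries_snd_diffs _ c K x _ _ _ xK); rewrite /c ?dpoly; exact: is_cvg_pseries_poly.
have dcvg : cvgn (pseries (pseries_diffs c) x).
  by rewrite /c dpoly; exact: is_cvg_pseries_poly.
set D := limn (pseries (pseries_diffs c) x) in dA.
set A := limn (pseries c x).
have x1n : 1 - x != 0.
  by rewrite subr_eq0; apply: contraTneq x1 => <-; rewrite normr1 ltxx.
pose P : {poly R} := (1 - 'X) ^+ m.+1.
have PE y : P.[y] = (1 - y) ^+ m.+1 by rewrite horner_exp !hornerE.
have P' : P^`() = - ((1 - 'X) ^+ m *+ m.+1).
  rewrite deriv_exp derivB derivX -polyC1 derivC polyC1/= sub0r.
  by rewrite mulN1r mulNrn.
have key : P.[x] * D + A * P^`().[x] - (eulerian_poly R 2 m)^`().[x] = 0.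
  apply: (@derive_near0 _ (horner P * (fun y => limn (pseries c y)) -
      horner (eulerian_poly R 2 m)) x).
    have : \forall y \near x, `|y| < 1.
      apply: (@cvgr_lt _ _ (nbhs x) _ (fun y => `|y|) `|x|) => //.
      exact: (@norm_continuous _ R^o).
    apply: filterS => y y1.
    change (P.[y] * limn (pseries c y) - (eulerian_poly R 2 m).[y] = 0).
    rewrite lc// PE mulVKf ?subrr// expf_neq0// subr_eq0.
    by apply: contraTneq y1 => <-; rewrite normr1 ltxx.
have lim1 : series (fun j => (2 * j + 1)%:R ^+ m.+1 * x ^+ j) @ \oo --> A + 2 * x * D.
  rewrite (_ : series _ = pseries c x + (2 * x) *: series
      (fun j => j%:R * c j * x ^+ j.-1)); last first.
    apply/funext => N; transitivity (\sum_(0 <= k < N) c k * x ^+ k +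
        2 * x * \sum_(0 <= k < N) k%:R * c k * x ^+ k.-1); last by [].
    rewrite /series/= mulr_sumr -big_split/=.
    apply: eq_bigr => j _; rewrite exprS -cE natrD natrM.
    by case: j => [|j]; rewrite /= ?expr0 ?(exprS x); ring.
  apply: cvgD; first by rewrite /c; exact: is_cvg_pseries_poly.
  by apply: cvgZr; exact: pseries_diffs_equiv.
suff -> : (1 - x) ^- m.+2 * (eulerian_poly R 2 m.+1).[x] = A + 2 * x * D by [].
have gS : (eulerian_poly R 2 m.+1).[x] = (1 + (2 * m + 1)%:R * x) * (eulerian_poly R 2 m).[x] +
    2 * (x * (1 - x) * (eulerian_poly R 2 m)^`().[x]).
  by rewrite eulerian_polyS -!polyC_natr !hornerE.
have P'x : P^`().[x] = - (m.+1%:R) * (1 - x) ^+ m.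
  by rewrite P' hornerN hornerMn horner_exp !hornerE -mulr_natl mulNr.
have x2 : (1 - x) ^+ m != 0 by rewrite expf_neq0.
move/eqP: key; rewrite subr_eq0 => /eqP; rewrite gS P'x PE /A lc// => <-.
rewrite !exprS; move: x1n x2; set u := (1 - x) ^+ m; move: (eulerian_poly R 2 m).[x] => g x1n x2.
by field; rewrite x1n x2.
Qed.

(** * Estimates for the exponential, the sine and the cosine *)

Lemma derive_ge0_le {R : realType} {f f' : R -> R} {x : R} :
  (forall t, is_derive t (1 : R) f (f' t)) -> (forall t, 0 <= t -> 0 <= f' t) ->
  0 <= x -> f 0 <= f x.
Proof.
move=> df f'0; rewrite le_eqVlt => /predU1P[<-//|x0].
have cf : {within `[0, x], continuous f}.
  by apply: derivable_within_continuous => t _; exact: ex_derive.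
have [c] := @MVT R f f' 0 x x0 (fun t _ => df t) cf.
rewrite in_itv/= => /andP[c0 _] E; rewrite -subr_ge0 E mulr_ge0 ?f'0// ?ltW//.
by rewrite subr_gt0.
Qed.

Lemma sin_le_id (R : realType) (x : R) : 0 <= x -> sin x <= x.
Proof.
move=> x0; have df t : is_derive t (1 : R) (id - sin : R -> R) (1 - cos t).
  exact: is_deriveB.
have : (id - sin) 0 <= (id - sin) x.
  by apply: (derive_ge0_le df _ x0) => t _; rewrite subr_ge0 cos_le1.
change (0 - sin 0 <= x - sin x -> sin x <= x).
by rewrite sin0 subrr subr_ge0.
Qed.

Lemma norm_sin_le (R : realType) (y : R) : `|sin y| <= `|y|.
Proof.
wlog y0 : y / 0 <= y.
  move=> W; have [y0|/ltW y0] := leP 0 y; first exact: W.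
  by rewrite -[leRHS]normrN -[leLHS]normrN -sinN; apply: W; rewrite oppr_ge0.
rewrite [leRHS]ger0_norm//.
have [y1|y1] := leP y 1; last by apply: le_trans (ltW y1); rewrite sin_max.
rewrite ger0_norm ?sin_le_id//.
by apply: sin_ge0_pi; rewrite y0 (le_trans y1)// (le_trans _ (pi_ge2 R))// ler1n.
Qed.

Lemma one_sub_cosE (R : realType) (y : R) : 1 - cos y = 2 * sin (y / 2) ^+ 2.
Proof.
have -> : cos y = cos (y / 2 *+ 2) by rewrite -(mulr_natr (y / 2)) divfK.
by rewrite cos_mulr2n sin2cos2; ring.
Qed.

Lemma one_sub_cos_le (R : realType) (y : R) : 1 - cos y <= y ^+ 2 / 2.
Proof.
wlog y0 : y / 0 <= y.
  move=> W; have [/W//|/ltW y0] := leP 0 y.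
  by rewrite -cosN -sqrrN; apply: W; rewrite oppr_ge0.
have := norm_sin_le (y / 2); rewrite [in leRHS]ger0_norm ?divr_ge0// => s.
have : sin (y / 2) ^+ 2 <= (y / 2) ^+ 2.
  by rewrite -[leLHS]real_normK ?num_real// lerXn2r// nnegrE ?divr_ge0.
by rewrite one_sub_cosE expr_div_n; lra.
Qed.

Lemma sin_ge_cubic (R : realType) (x : R) : 0 <= x -> x - x ^+ 3 / 6 <= sin x.
Proof.
move=> x0; pose p : {poly R} := 6^-1 *: 'X^3 - 'X.
have df t : is_derive t (1 : R) (sin + horner p) (cos t + p^`().[t]).
  by apply: is_deriveD.
have p't t : p^`().[t] = t ^+ 2 / 2 - 1.
  rewrite /p derivB derivZ derivXn derivX !hornerE/=.
  by lra.
have : 0 + p.[0] <= sin x + p.[x].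
  rewrite -[X in X + _ <= _]sin0; apply: (derive_ge0_le df _ x0) => t t0.
  by rewrite p't; have := one_sub_cos_le t; lra.
have pE t : p.[t] = t ^+ 3 / 6 - t.
  by rewrite /p hornerD hornerN hornerZ hornerXn hornerX mulrC.
by rewrite !pE expr0n/= mul0r subrr addr0; lra.
Qed.

(** Everything needed about [exp] on [-1, 0] to compare [e^v - 1] with [v] in the
    strip around the pole. *)
Lemma one_sub_expR_bounds (R : realType) (x : R) : -1 <= x <= 0 ->
  [/\ 1 / 4 <= expR x, expR x <= 1, - x / 2 <= 1 - expR x, 1 - expR x <= - x &
      expR x - 1 - x <= x ^+ 2].
Proof.
move=> /andP[x1 x0].
have e0 := expR_gt0 x.
have e1 : expR x <= 1 by rewrite -expR0 ler_expR.
have h1 : expR x * (1 - x) <= 1.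
  rewrite -[leRHS](expRxMexpNx_1 x) ler_wpM2l ?expR_ge0//.
  exact: expR_ge1Dx.
have h2 := expR_ge1Dx x.
have h4 : 1 / 4 <= expR x.
  have := expR_ge1Dx (x / 2) => h.
  have -> : expR x = expR (x / 2) * expR (x / 2).
    by rewrite -expRD; congr expR; lra.
  by nra.
by split => //; [nra|lra|nra].
Qed.

Lemma one_sub_cos_ge (R : realType) (y : R) : `|y| <= pi -> y ^+ 2 / 18 <= 1 - cos y.
Proof.
wlog y0 : y / 0 <= y.
  move=> W yp; have [y0|/ltW y0] := leP 0 y; first exact: W.
  by rewrite -cosN -sqrrN; apply: W; rewrite ?normrN// oppr_ge0.
rewrite ger0_norm// => yp.
(* For [y / 2 <= 2] the cubic term is at most two thirds of the linear one. *)
have y4 : y / 2 <= 2.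
  by have := pihalf_lt2 R; lra.
have s : y / 6 <= sin (y / 2).
  apply: le_trans (sin_ge_cubic _); last by lra.
  by nra.
rewrite one_sub_cosE.
have := ler_pM _ _ s s; rewrite -!expr2 => /(_ _ _) h.
have {}h := h (divr_ge0 y0 (ler0n _ _)) (divr_ge0 y0 (ler0n _ _)).
by lra.
Qed.

Lemma sin_sub_id_le (R : realType) (y : R) : `|y| <= pi -> `|sin y - y| <= y ^+ 2.
Proof.
wlog y0 : y / 0 <= y.
  move=> W yp; have [y0|/ltW y0] := leP 0 y; first exact: W.
  have -> : sin y - y = - (sin (- y) - (- y)) by rewrite sinN; ring.
  by rewrite normrN -sqrrN; apply: W; rewrite ?normrN// oppr_ge0.
rewrite (ger0_norm y0) => yp; have h1 := sin_le_id y0; have h2 := sin_ge_cubic y0.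
have y4 : y / 2 <= 2 by have := pihalf_lt2 R; lra.
rewrite ler_norml; apply/andP; split; last by nra.
have : y ^+ 3 <= 4 * y ^+ 2 by rewrite exprS ler_wpM2r ?sqr_ge0//; lra.
by have := sqr_ge0 y; lra.
Qed.

(** * Modulus and exponential of complex numbers *)

Lemma normc_ge0 (R : rcfType) (z : R[i]) : 0 <= normc z.
Proof. by case: z => a b; exact: sqrtr_ge0. Qed.

Lemma normc_eq0 (R : rcfType) (z : R[i]) : (normc z == 0) = (z == 0).
Proof. by apply/eqP/eqP => [/eq0_normc//|->]; exact: normc0. Qed.

Lemma normc_gt0 (R : rcfType) (z : R[i]) : (0 < normc z) = (z != 0).
Proof. by rewrite lt_def normc_eq0 normc_ge0 andbT. Qed.

Lemma normcD_le (R : rcfType) (x y : R[i]) : normc (x + y) <= normc x + normc y.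
Proof. exact: le_normcD. Qed.

Lemma normcX (R : rcfType) (z : R[i]) n : normc (z ^+ n) = normc z ^+ n.
Proof.
by elim: n => [|n IH]; [rewrite !expr0; exact: normc1|rewrite !exprS normcM IH].
Qed.

Lemma normc_sum_le (R : rcfType) I (r : seq I) (P : pred I) (F : I -> R[i]) :
  normc (\sum_(i <- r | P i) F i) <= \sum_(i <- r | P i) normc (F i).
Proof.
elim/big_rec2: _ => [|i x y _ h]; first by rewrite (normc0 R).
by apply: le_trans (normcD_le _ _) _; rewrite lerD2l.
Qed.

Lemma normc_sqr (R : rcfType) (a b : R) :
  normc (Complex a b) ^+ 2 = a ^+ 2 + b ^+ 2.
Proof. by rewrite sqr_sqrtr// addr_ge0// sqr_ge0. Qed.

Lemma normc_real (R : rcfType) (r : R) : normc (real_complex R r) = `|r|.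
Proof. by rewrite /= expr0n addr0 sqrtr_sqr. Qed.

Lemma normc_nat (R : rcfType) n : normc (n%:R : R[i]) = n%:R.
Proof. by rewrite -(rmorph_nat (real_complex R)) normc_real ger0_norm. Qed.

Lemma Re_le_normc (R : rcfType) (z : R[i]) : `|complex.Re z| <= normc z.
Proof.
case: z => a b /=; rewrite -sqrtr_sqr ler_wsqrtr// lerDl; exact: sqr_ge0.
Qed.

Lemma Im_le_normc (R : rcfType) (z : R[i]) : `|complex.Im z| <= normc z.
Proof.
case: z => a b /=; rewrite -sqrtr_sqr ler_wsqrtr// lerDr; exact: sqr_ge0.
Qed.

Lemma normc_le_ReIm (R : rcfType) (z : R[i]) :
  normc z <= `|complex.Re z| + `|complex.Im z|.
Proof.
have E (c d : R) : normc (Complex c 0) + normc (Complex 0 d) = `|c| + `|d|.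
  by rewrite /= expr0n/= addr0 add0r !sqrtr_sqr.
case: z => a b /=; rewrite -E; apply: le_trans (normcD_le _ _).
by rewrite /= addr0 add0r.
Qed.

Definition cexp (R : realType) (z : R[i]) : R[i] :=
  Complex (expR (complex.Re z) * cos (complex.Im z))
          (expR (complex.Re z) * sin (complex.Im z)).

Lemma cexpD (R : realType) (z w : R[i]) : cexp (z + w) = cexp z * cexp w.
Proof.
case: z w => a b [c d]; rewrite /cexp /= expRD sinD cosD.
by apply/eqP; rewrite eq_complex /=; apply/andP; split; apply/eqP; ring.
Qed.

Lemma normc_cexp (R : realType) (z : R[i]) : normc (cexp z) = expR (complex.Re z).
Proof.
case: z => a b; rewrite /cexp /= !exprMn -mulrDr cos2Dsin2 mulr1 sqrtr_sqr.
by rewrite ger0_norm// expR_ge0.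
Qed.

Lemma cexp_Dpi (R : realType) (z : R[i]) : cexp (z + Complex 0 pi) = - cexp z.
Proof. by case: z => a b; rewrite /cexp /= addr0 sinDpi cosDpi !mulrN. Qed.

Lemma cexp_periodic (R : realType) (z : R[i]) :
  cexp (z + Complex 0 (2 * pi)) = cexp z.
Proof.
by case: z => a b; rewrite /cexp /= addr0 mulr_natl sinD2pi cosD2pi.
Qed.

Lemma cexp_sqr (R : realType) (z : R[i]) : cexp (2 * z) = cexp z ^+ 2.
Proof. by rewrite mulr_natl mulr2n cexpD expr2. Qed.

Lemma cexpX_neq1 (R : realType) (z : R[i]) n : complex.Re z < 0 ->
  cexp z ^+ n.+1 != 1.
Proof.
move=> z0; apply/negP => /eqP /(congr1 (@normc R)).
rewrite normcX normc_cexp (normc1 R) => /eqP.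
by rewrite lt_eqF// exprn_ilt1 ?expR_ge0// expR_lt1.
Qed.

(** In polar coordinates,
    [|e^(x + i y) - 1|^2 = (1 - e^x)^2 + 2 e^x (1 - cos y)]: both terms are bounded
    below by a multiple of [x^2] and of [y^2], the second as long as
    [|y| <= pi], i.e. when [0] is the nearest zero of [e^v - 1]. *)
Lemma normc_cexp_sub1_ge (R : realType) (v : R[i]) :
  -1 <= complex.Re v <= 0 -> `|complex.Im v| <= pi ->
  normc v <= 6 * normc (cexp v - 1).
Proof.
case: v => x y /= xb yb; have := one_sub_cos_ge yb.
have [e4 e1 h1 h2 h3] := one_sub_expR_bounds xb => hc.
rewrite -[leRHS]ger0_norm; last by rewrite mulr_ge0// sqrtr_ge0.
rewrite -sqrtr_sqr ler_wsqrtr// exprMn sqr_sqrtr; last by rewrite addr_ge0// sqr_ge0.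
have sc := cos2Dsin2 y.
have -> : (expR x * cos y - 1) ^+ 2 + (expR x * sin y - 0) ^+ 2 =
    (1 - expR x) ^+ 2 + 2 * expR x * (1 - cos y).
  by rewrite (_ : _ + _ = expR x ^+ 2 * (cos y ^+ 2 + sin y ^+ 2) + 1 -
    2 * expR x * cos y); [rewrite sc; ring|ring].
have k1 : (x / 2) ^+ 2 <= (1 - expR x) ^+ 2 by rewrite -sqrrN -mulNr lerXn2r// nnegrE; lra.
have k2 : 1 / 2 * (y ^+ 2 / 18) <= 2 * expR x * (1 - cos y).
  by apply: ler_pM => //; have := sqr_ge0 y; lra.
by have := sqr_ge0 x; rewrite expr_div_n in k1; lra.
Qed.

Lemma normc_cexp_sub1_id_le (R : realType) (v : R[i]) :
  -1 <= complex.Re v <= 0 -> `|complex.Im v| <= pi ->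
  normc (cexp v - 1 - v) <= 3 * normc v ^+ 2.
Proof.
case: v => x y xb yb; rewrite normc_sqr; apply: le_trans (normc_le_ReIm _) _.
move: xb yb; rewrite /= subr0 => xb yb.
have [e4 e1 h1 h2 h3] := one_sub_expR_bounds xb; have e0 := expR_gt0 x.
have hc := one_sub_cos_le y; have c1 := cos_le1 y.
have x0 : x <= 0 by case/andP: xb.
have re : `|expR x * cos y - 1 - x| <= x ^+ 2 + y ^+ 2 / 2.
  have -> : expR x * cos y - 1 - x = (expR x - 1 - x) - expR x * (1 - cos y) by ring.
  apply: le_trans (ler_normB _ _) _; apply: lerD.
    by rewrite ger0_norm//; have := expR_ge1Dx x; lra.
  rewrite ger0_norm; last by rewrite mulr_ge0// ?ltW//; lra.
  by apply: le_trans hc; rewrite ler_piMl//; lra.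
have im : `|expR x * sin y - y| <= (x ^+ 2 + y ^+ 2) / 2 + y ^+ 2.
  have -> : expR x * sin y - y = (expR x - 1) * sin y + (sin y - y) by ring.
  apply: le_trans (ler_normD _ _) _; apply: lerD; last exact: sin_sub_id_le.
  rewrite normrM; apply: (@le_trans _ _ (`|x| * `|y|)).
    apply: ler_pM => //; last exact: norm_sin_le.
    by rewrite ler0_norm ?ler0_norm//; lra.
  rewrite -[in leRHS](real_normK (num_real x)) -[in leRHS](real_normK (num_real y)).
  by have := sqr_ge0 (`|x| - `|y|); nra.
by have := sqr_ge0 x; have := sqr_ge0 y; lra.
Qed.

(** * Polylogarithms of negative order *)

(** The even part of [polylog_num_even_odd]: the odd parts cancel between [z] and
    [- z]. *)
Lemma polylog_num_duplication (F : fieldType) m (z : F) : z ^+ 2 != 1 ->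
  (polylog_num F m).[z] / (1 - z) ^+ m.+1 + (polylog_num F m).[- z] / (1 + z) ^+ m.+1 =
  2 ^+ m.+1 * ((polylog_num F m).[z ^+ 2] / (1 - z ^+ 2) ^+ m.+1).
Proof.
move=> z2; have E : 1 - z ^+ 2 = (1 - z) * (1 + z) by ring.
have : 1 - z ^+ 2 != 0 by rewrite subr_eq0 eq_sym.
rewrite E mulf_eq0 negb_or => /andP[zm zp].
have := horner_polylog_num_even_odd m (- z); have := horner_polylog_num_even_odd m z.
rewrite sqrrN => e1 e2.
have a0 : (1 - z) ^+ m.+1 != 0 by rewrite expf_neq0.
have b0 : (1 + z) ^+ m.+1 != 0 by rewrite expf_neq0.
rewrite exprMn; apply: (mulIf (mulf_neq0 a0 b0)).
rewrite -[in RHS]mulrA (mulfVK (mulf_neq0 a0 b0)).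
transitivity ((polylog_num F m).[z] * (1 + z) ^+ m.+1 +
  (polylog_num F m).[- z] * (1 - z) ^+ m.+1); last by rewrite e1 e2 (exprS 2 m); ring.
by field; rewrite a0 b0.
Qed.

(** The function [Li_(-m)(e^w)]. *)
Definition polylog (R : realType) m (w : R[i]) : R[i] :=
  (polylog_num R[i] m).[cexp w] / (1 - cexp w) ^+ m.+1.

Lemma polylog_duplication (R : realType) m (v : R[i]) : complex.Re v < 0 ->
  polylog m v + polylog m (v + Complex 0 pi) = 2 ^+ m.+1 * polylog m (2 * v).
Proof.
move=> v0; rewrite /polylog cexp_Dpi opprK cexp_sqr polylog_num_duplication//.
exact: cexpX_neq1.
Qed.

Lemma polylog_periodic (R : realType) m (v : R[i]) :
  polylog m (v + Complex 0 (2 * pi)) = polylog m v.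
Proof. by rewrite /polylog cexp_periodic. Qed.

(** The point [(w + i t) / 2^N], given by coordinates so that its real and
    imaginary parts are available by computation. *)
Definition division_point (R : realType) (w : R[i]) (t : R) N : R[i] :=
  Complex (complex.Re w / 2 ^+ N) ((complex.Im w + t) / 2 ^+ N).

Lemma division_pointE (R : realType) (w : R[i]) t N :
  2 ^+ N * division_point w t N = w + Complex 0 t.
Proof.
have -> : (2 ^+ N : R[i]) = real_complex R (2 ^+ N) by rewrite rmorphXn rmorph_nat.
have n0 : (2 ^+ N : R) != 0 by rewrite expf_neq0.
case: w => a b; apply/eqP; rewrite eq_complex /=.
by rewrite !mul0r subr0 !addr0 !(mulrC (2 ^+ N)) !mulfVK// !eqxx.
Qed.

Lemma sum_pow2S (V : nmodType) (g : nat -> V) N :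
  \sum_(0 <= k < 2 ^ N.+1) g k = \sum_(0 <= k < 2 ^ N) (g k + g (k + 2 ^ N)%N).
Proof.
rewrite (@big_cat_nat _ _ _ (2 ^ N))//=; last by rewrite leq_exp2l.
by rewrite [X in _ + X]sum_shift0 big_split expnS mul2n -addnn addnK.
Qed.

(** The indices of the upper half, counted from the end, stand for the negative
    indices modulo [2^(N+1)]. *)
Lemma sum_pow2S_rev (V : nmodType) (g : nat -> V) N :
  \sum_(0 <= k < 2 ^ N.+1) g k =
  \sum_(0 <= k < 2 ^ N) (g k + g (2 ^ N.+1 - k.+1)%N).
Proof.
rewrite sum_pow2S !big_split/=; congr (_ + _).
rewrite big_nat_rev/=; apply: eq_big_nat => k /andP[_ kN]; congr g.
by rewrite add0n expnS mul2n -addnn; lia.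
Qed.

Lemma polylog_multisection (R : realType) m (w : R[i]) N : complex.Re w < 0 ->
  2 ^+ (m.+1 * N) * polylog m w =
  \sum_(0 <= k < 2 ^ N) polylog m (division_point w (2 * pi * k%:R) N).
Proof.
move=> w0; elim: N => [|N IH].
  rewrite muln0 mul1r big_nat1 /division_point expr0 !divr1 mulr0 addr0.
  by case: w w0.
rewrite mulnS exprD -mulrA IH mulr_sumr sum_pow2S; apply: eq_bigr => k _.
have d2 t : division_point w t N = 2 * division_point w t N.+1.
  apply: (@mulfI _ (2 ^+ N)); first by rewrite expf_neq0.
  by rewrite division_pointE mulrA -exprSr division_pointE.
(* The second half-point is a division point of index [k + 2^N]. *)
rewrite d2 -polylog_duplication; last first.
  by rewrite /= pmulr_llt0// invr_gt0 exprn_gt0.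
congr (_ + polylog m _); apply/eqP; rewrite eq_complex /= addr0 eqxx/=.
have n0 : (2 ^+ N.+1 : R) != 0 by rewrite expf_neq0.
apply/eqP; apply: (mulIf n0); rewrite [in LHS]mulrDl !mulfVK// natrD exprS natrX; ring.
Qed.

(** With indices running over [- 2^N <= k < 2^N] instead of
    [0 <= k < 2^(N+1)], all the points lie in the strip [|Im v| <= pi] where
    [polylog_pole] applies. *)
Lemma polylog_centered_multisection (R : realType) m (w : R[i]) N :
  complex.Re w < 0 -> 2 ^+ (m.+1 * N.+1) * polylog m w =
  \sum_(0 <= k < 2 ^ N) (polylog m (division_point w (2 * pi * k%:R) N.+1) +
     polylog m (division_point w (- (2 * pi * k.+1%:R)) N.+1)).
Proof.
move=> w0; rewrite polylog_multisection// sum_pow2S_rev.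
apply: eq_big_nat => k /andP[_ kN].
suff -> : division_point w (2 * pi * (2 ^ N.+1 - k.+1)%:R) N.+1 =
    division_point w (- (2 * pi * k.+1%:R)) N.+1 + Complex 0 (2 * pi).
  by rewrite polylog_periodic.
apply/eqP; rewrite eq_complex /= addr0 eqxx/=.
have n0 : (2 ^+ N.+1 : R) != 0 by rewrite expf_neq0.
apply/eqP; apply: (mulIf n0); rewrite [in RHS]mulrDl !mulfVK// natrB ?natrX; last first.
  by rewrite expnS; lia.
ring.
Qed.

Lemma poly_lipschitz_at1 (R : rcfType) (p : {poly R[i]}) :
  exists2 K : R, 0 <= K & forall e, normc e <= 1 ->
    normc (p.[e] - p.[1]) <= K * normc (e - 1).
Proof.
have : root (p - (p.[1])%:P) 1 by rewrite rootE hornerD hornerN hornerC subrr.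
move=> /factor_theorem[q qE]; exists (\sum_(i < size q) normc q`_i).
  by apply: sumr_ge0 => i _; exact: normc_ge0.
move=> e e1.
have -> : p.[e] - p.[1] = q.[e] * (e - 1).
  have /(congr1 (horner^~ e)) := qE.
  by rewrite hornerD hornerN hornerC hornerM hornerXsubC.
rewrite normcM ler_wpM2r ?normc_ge0// horner_coef.
apply: le_trans (normc_sum_le _ _ _) _; apply: ler_sum => i _.
by rewrite normcM normcX ler_piMr ?normc_ge0// exprn_ile1 ?normc_ge0.
Qed.

(** With [d = e^v - 1] and [r = v / d], one has
    [(- v)^(m+1) Li_(-m)(e^v) = E_m(e^v) r^(m+1)]; here [E_m(e^v)] is within [O(d)]
    of [m!], and [r] is bounded and within [O(v)] of [1]. *)
Lemma polylog_pole (R : realType) m : exists2 C : R, 0 <= C &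
  forall v : R[i], -1 <= complex.Re v < 0 -> `|complex.Im v| <= pi ->
    normc (polylog m v - m`!%:R * (- v) ^- m.+1) <= C * normc v ^- m.
Proof.
have [K K0 lipK] := poly_lipschitz_at1 (polylog_num R[i] m).
exists (6 ^+ m * (K + 18 * m.+1%:R * m`!%:R)) => [|v /andP[v1 v0] vp].
  by rewrite mulr_ge0 ?exprn_ge0// addr_ge0// !mulr_ge0.
have v10 : -1 <= complex.Re v <= 0 by rewrite v1 ltW.
have vn0 : v != 0 by apply: contraTneq v0 => ->; rewrite ltxx.
have nv0 : 0 < normc v by rewrite normc_gt0.
have lb := normc_cexp_sub1_ge v10 vp; have ub := normc_cexp_sub1_id_le v10 vp.
have e1 : normc (cexp v) <= 1 by rewrite normc_cexp -expR0 ler_expR ltW.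
have := lipK _ e1; rewrite polylog_num_at1.
set e := cexp v in lb ub e1 *; set d := e - 1 in lb ub * => lip.
have nd0 : 0 < normc d by lra.
have dn0 : d != 0 by rewrite -normc_gt0.
pose r := v / d.
have rd : normc r * normc d = normc v.
  by rewrite -normcM /r mulfVK.
have r6 : normc r <= 6.
  by rewrite -(ler_pM2r nd0) rd.
have r1 : normc (r - 1) <= 18 * normc v.
  rewrite -(ler_pM2r nd0) -normcM mulrBl mul1r /r mulfVK// -normcN opprB.
  apply: le_trans ub _; rewrite expr2 mulrA (mulrAC _ _ (normc d)).
  by rewrite -(mulrA 18) mulrCA mulrC; have := ler_wpM2l (ltW nv0) lb; lra.
have rX j : normc (r ^+ j) <= 6 ^+ j.
  by rewrite normcX lerXn2r ?nnegrE ?normc_ge0.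
have E : polylog m v - m`!%:R * (- v) ^- m.+1 =
    (((polylog_num R[i] m).[e] - m`!%:R) * r ^+ m.+1 +
     m`!%:R * (r ^+ m.+1 - 1)) * (- v) ^- m.+1.
  have -> : polylog m v = (polylog_num R[i] m).[e] * r ^+ m.+1 * (- v) ^- m.+1.
    rewrite /polylog -/e -mulrA; congr (_ * _).
    have -> : 1 - e = - d by rewrite /d opprB.
    have -> : r = (- v) / (- d) by rewrite invrN mulrNN.
    by rewrite expr_div_n mulrAC divff ?mul1r// expf_neq0// oppr_eq0.
  ring.
rewrite E normcM normcV normcX normcN (exprS (normc v)) invfM mulrA.
rewrite ler_wpM2r ?invr_ge0 ?exprn_ge0 ?normc_ge0//.
rewrite ler_pdivrMr//.
apply: le_trans (normcD_le _ _) _; rewrite [in leRHS]mulrDr [in leRHS]mulrDl; apply: lerD.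
  rewrite exprS normcM normcM mulrA.
  apply: (@le_trans _ _ (K * normc v * 6 ^+ m)); last by rewrite mulrC mulrA.
  rewrite ler_pM ?mulr_ge0 ?normc_ge0//.
  by rewrite -rd (mulrC (normc r)) mulrA ler_wpM2r ?normc_ge0.
rewrite normcM normc_nat subrX1 normcM.
have sumr6 : normc (\sum_(i < m.+1) r ^+ i) <= m.+1%:R * 6 ^+ m.
  apply: le_trans (normc_sum_le _ _ _) _.
  rewrite mulr_natl -[X in _ *+ X]card_ord -sumr_const; apply: ler_sum => i _.
  apply: le_trans (rX i) _; apply: ler_weXn2l; first by rewrite ler1n.
  by rewrite -ltnS.
apply: (@le_trans _ _ (m`!%:R * ((18 * normc v) * (m.+1%:R * 6 ^+ m)))).
  by rewrite ler_wpM2l// ler_pM ?normc_ge0.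
by rewrite le_eqVlt; apply/orP; left; apply/eqP; ring.
Qed.

Lemma sum_inv_sqr_le (R : realFieldType) n :
  \sum_(0 <= k < n) (k.+1%:R ^+ 2)^-1 <= 2 :> R.
Proof.
suff H : \sum_(0 <= k < n.+1) (k.+1%:R ^+ 2)^-1 <= 2 - n.+1%:R^-1 :> R.
  apply: le_trans (_ : _ <= 2 - n.+1%:R^-1) _; last by rewrite gerBl invr_ge0.
  by apply: le_trans H; rewrite big_nat_recr//= lerDl invr_ge0 sqr_ge0.
elim: n => [|n IH]; first by rewrite big_nat1 expr1n invr1; lra.
rewrite big_nat_recr//=; apply: le_trans (lerD IH (lexx _)) _.
rewrite -addrA lerD2l -lerBrDl opprK.
have p1 : (0 : R) < n.+1%:R by rewrite ltr0n.
have p2 : (0 : R) < n.+2%:R by rewrite ltr0n.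
have -> : - n.+2%:R^-1 + n.+1%:R^-1 = (n.+2%:R * n.+1%:R)^-1 :> R.
  rewrite -[n.+2%:R]natr1 in p2 *.
  by field; rewrite !gt_eqF.
by rewrite lef_pV2 ?posrE ?exprn_gt0 ?mulr_gt0// expr2 ler_wpM2l// ler_nat.
Qed.

Lemma le_of_le_add_pow2 (R : realType) (x y c : R) N0 : 0 <= c ->
  (forall N, (N0 <= N)%N -> x <= y + c / 2 ^+ N) -> x <= y.
Proof.
move=> c0 H; rewrite leNgt; apply/negP => yx.
have d0 : 0 < x - y by rewrite subr_gt0.
have := archi_boundP (divr_ge0 c0 (ltW d0)); set M := Num.bound _ => cM.
have := H (maxn N0 M) (leq_maxl _ _); apply/negP; rewrite -ltNge -ltrBrDl.
rewrite ltr_pdivrMr ?exprn_gt0// mulrC -ltr_pdivrMr//.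
apply: lt_le_trans cM _; rewrite -natrX ler_nat.
by apply: leq_trans (ltnW (ltn_expl _ (isT : 1 < 2)%N)) _; rewrite leq_exp2l// leq_maxr.
Qed.

(** * Expansion of the polylogarithm over its poles *)

(** A common lower bound for the distances from [w = - a + i b] to the poles
    [- 2 pi i k] and [2 pi i (k + 1)] when [b <= pi]. *)
Definition pole_dist (R : rcfType) (a b : R) (k : nat) : R :=
  normc (Complex a ((2 * k + 1)%:R * b)).

Lemma pole_dist_gt0 (R : rcfType) (a b : R) k : 0 < a -> 0 < pole_dist a b k.
Proof.
by move=> a0; rewrite normc_gt0 eq_complex /= negb_and gt_eqF.
Qed.

Lemma pole_dist_sqr (R : rcfType) (a b : R) k :
  pole_dist a b k ^+ 2 = a ^+ 2 + (2 * k + 1)%:R ^+ 2 * b ^+ 2.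
Proof. by rewrite normc_sqr exprMn. Qed.

Lemma ler_normc_sqr (R : rcfType) (z w : R[i]) :
  (normc z <= normc w) = (normc z ^+ 2 <= normc w ^+ 2).
Proof. by rewrite ler_pXn2r// nnegrE normc_ge0. Qed.

Lemma pole_dist_le (R : rcfType) (a b t : R) k : 0 <= b ->
  (2 * k + 1)%:R * b <= `|t| -> pole_dist a b k <= normc (Complex (- a) t).
Proof.
move=> b0 bt; rewrite ler_normc_sqr !normc_sqr sqrrN lerD2l.
by rewrite -[leRHS]real_normK ?num_real// ler_pXn2r ?nnegrE ?mulr_ge0.
Qed.

Lemma shifted_pole_bounds (R : realFieldType) (p b k M : R) :
  0 < b -> b <= p -> 0 <= k -> k + 1 <= M ->
  [/\ `|b + 2 * p * k| <= p * (2 * M), (2 * k + 1) * b <= `|b + 2 * p * k|,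
      `|b - 2 * p * (k + 1)| <= p * (2 * M) &
      (2 * k + 1) * b <= `|b - 2 * p * (k + 1)|].
Proof.
move=> b0 bp k0 kM; have p0 : 0 < p by apply: lt_le_trans bp.
have bk : k * b <= k * p by rewrite ler_wpM2l.
have kb0 : 0 <= k * b by rewrite mulr_ge0// ltW.
have pM : p * (k + 1) <= p * M by rewrite ler_wpM2l// ltW.
have n1 : `|b + 2 * p * k| = b + 2 * p * k by rewrite ger0_norm//; lra.
have n2 : `|b - 2 * p * (k + 1)| = 2 * p * (k + 1) - b.
  by rewrite ler0_norm; lra.
by rewrite n1 n2; split; lra.
Qed.

Section PoleExpansion.
Variables (R : realType) (m : nat) (a b C : R).
Hypotheses (a0 : 0 < a) (b0 : 0 < b) (bpi : b <= pi) (C0 : 0 <= C).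
Hypothesis polylogC : forall v : R[i], -1 <= complex.Re v < 0 ->
  `|complex.Im v| <= pi ->
  normc (polylog m v - m`!%:R * (- v) ^- m.+1) <= C * normc v ^- m.
Let w : R[i] := Complex (- a) b.
Let pole (t : R) : R[i] := (- (w + Complex 0 t)) ^- m.+1.

Let node_bound N t k : a <= 2 ^+ N -> `|b + t| <= pi * 2 ^+ N ->
  (2 * k + 1)%:R * b <= `|b + t| ->
  normc (polylog m (division_point w t N) - 2 ^+ N ^+ m.+1 * (m`!%:R * pole t)) <=
  C * 2 ^+ N ^+ m * pole_dist a b k ^- m.
Proof.
move=> aN tN tk; set v := division_point w t N.
have M0 : (0 : R) < 2 ^+ N by rewrite exprn_gt0.
have M0' : (2 ^+ N : R[i]) != 0 by rewrite expf_neq0// pnatr_eq0.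
have nM : normc (2 ^+ N : R[i]) = 2 ^+ N by rewrite normcX normc_nat.
have wt : w + Complex 0 t = 2 ^+ N * v by rewrite division_pointE.
have v1 : -1 <= complex.Re v < 0.
  by rewrite /= mulNr lerN2 ler_pdivrMr// mul1r aN oppr_lt0 divr_gt0.
have v2 : `|complex.Im v| <= pi.
  by rewrite /= normrM [`|_^-1|]gtr0_norm ?invr_gt0// ler_pdivrMr.
have -> : 2 ^+ N ^+ m.+1 * (m`!%:R * pole t) = m`!%:R * (- v) ^- m.+1.
  rewrite /pole wt -mulrN exprMn invfM mulrCA; congr (_ * _).
  by rewrite mulrA divff ?mul1r// expf_neq0.
apply: le_trans (polylogC v1 v2) _; rewrite -mulrA ler_wpM2l//.
have h0 := pole_dist_gt0 b k a0.
have hv : pole_dist a b k <= 2 ^+ N * normc v.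
  rewrite -nM -normcM -wt /= addr0.
  by apply: pole_dist_le => //; exact: ltW.
have v0 : 0 < normc v by rewrite -(pmulr_rgt0 _ M0) (lt_le_trans h0).
rewrite -ler_pdivrMl ?exprn_gt0// -invfM -exprMn lef_pV2 ?posrE ?exprn_gt0 ?mulr_gt0//.
by apply: lerXn2r => //; rewrite nnegrE ltW ?mulr_gt0.
Qed.

(** The pole part at [division_point w t N] is homogeneous of degree [- (m + 1)],
    so the factor [2^(N(m+1))] of the multisection formula turns it into the pole
    part at [w + i t]; the error term has degree [- m] only, and one factor
    [1 / 2^N] is left. *)
Lemma polylog_partial_poles N : a <= 2 ^+ N.+1 ->
  normc (polylog m w - m`!%:R * \sum_(0 <= k < 2 ^ N)
    (pole (2 * pi * k%:R) + pole (- (2 * pi * k.+1%:R)))) <=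
  C / 2 ^+ N.+1 * \sum_(0 <= k < 2 ^ N) 2 * pole_dist a b k ^- m.
Proof.
move=> aN; have M0 : (0 : R) < 2 ^+ N.+1 by rewrite exprn_gt0.
have nM : normc (2 ^+ N.+1 : R[i]) = 2 ^+ N.+1 by rewrite normcX normc_nat.
have pi0 := pi_gt0 R.
rewrite -(ler_pM2l (exprn_gt0 m.+1 M0)).
rewrite -{1}nM -normcX -normcM mulrBr -exprM mulnC.
rewrite polylog_centered_multisection; last by rewrite /= oppr_lt0.
rewrite mulnC exprM !mulr_sumr -sumrB.
apply: le_trans (normc_sum_le _ _ _) _.
rewrite big_nat_cond [leRHS]big_nat_cond; apply: ler_sum => k /andP[/andP[_ kN] _].
have kN' : k.+1%:R <= 2 ^+ N :> R by rewrite -natrX ler_nat.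
have k0 : 0 <= k%:R :> R by [].
have kS : k.+1%:R = k%:R + 1 :> R by rewrite -natr1.
have k2 : (2 * k + 1)%:R = 2 * k%:R + 1 :> R by rewrite natrD natrM.
have e2 : 2 ^+ N.+1 = 2 * 2 ^+ N :> R by rewrite exprS.
rewrite kS in kN'.
have [n1 n2 n3 n4] := shifted_pole_bounds b0 bpi k0 kN'.
rewrite (mulrDr m`!%:R) (mulrDr (2 ^+ N.+1 ^+ m.+1)) opprD addrACA.
apply: le_trans (normcD_le _ _) _.
have -> : 2 ^+ N.+1 ^+ m.+1 * (C / 2 ^+ N.+1 * (2 * pole_dist a b k ^- m)) =
  C * 2 ^+ N.+1 ^+ m * pole_dist a b k ^- m +
  C * 2 ^+ N.+1 ^+ m * pole_dist a b k ^- m.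
  rewrite (exprS _ m); move: (pole_dist a b k ^- m) (_ ^+ m) => p q.
  by field; rewrite gt_eqF.
by rewrite -e2 in n1 n3; apply: lerD; apply: node_bound; rewrite ?k2 ?kS.
Qed.
End PoleExpansion.

Lemma pole_dist_ge (R : rcfType) (a b : R) k : 0 <= b ->
  k.+1%:R * b <= pole_dist a b k.
Proof.
move=> b0; apply: le_trans (Im_le_normc _); apply: le_trans (ler_norm _).
by rewrite /= ler_wpM2r// ler_nat; lia.
Qed.

Lemma pole_dist_mono (R : rcfType) (a b : R) j k : (j <= k)%N ->
  pole_dist a b j <= pole_dist a b k.
Proof.
move=> jk; rewrite ler_normc_sqr !pole_dist_sqr lerD2l ler_wpM2r ?sqr_ge0//.
by rewrite ler_pXn2r ?nnegrE// ler_nat; lia.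
Qed.

(** The tails converge because [m + 2 >= 2]: the squares of the distances control
    the sums, and the remaining powers are bounded by those of [pole_dist a b 1],
    below which no discarded distance falls. *)
Lemma polylog_two_poles (R : realType) m (a b : R) : 0 < a -> 0 < b -> b <= pi ->
  normc (polylog m.+2 (Complex (- a) b) - m.+2`!%:R *
     ((- Complex (- a) b) ^- m.+3 + (- Complex (- a) (b - 2 * pi)) ^- m.+3)) <=
  m.+2`!%:R * (2 / b ^+ 2 * pole_dist a b 1 ^- m.+1).
Proof.
move=> a0 b0 bpi; have [C C0 polylogC] := polylog_pole R m.+2.
set w := Complex (- a) b; set f := polylog _ w.
pose pole t := (- (w + Complex 0 t)) ^- m.+3.
pose g k := pole (2 * pi * k%:R) + pole (- (2 * pi * k.+1%:R)).
have h0 k : 0 < pole_dist a b k by exact: pole_dist_gt0.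
have kb0 k : 0 < k.+1%:R * b by rewrite mulr_gt0.
have hge k : k.+1%:R * b <= pole_dist a b k by apply: pole_dist_ge; exact: ltW.
have pole_le t k : (2 * k + 1)%:R * b <= `|b + t| ->
    normc (pole t) <= pole_dist a b k ^- m.+3.
  move=> tk; have := pole_dist_le a (ltW b0) tk.
  have -> : Complex (- a) (b + t) = w + Complex 0 t by rewrite /= -[RHS]/(Complex _ _) addr0.
  move=> le; rewrite /pole normcV normcX normcN lef_pV2 ?posrE ?exprn_gt0//.
    by apply: lerXn2r => //; rewrite nnegrE ?normc_ge0// ltW.
  exact: lt_le_trans le.
have g_le k : normc (g k) <= 2 * pole_dist a b k ^- m.+3.
  have kS : k.+1%:R = k%:R + 1 :> R by rewrite -natr1.
  have k2 : (2 * k + 1)%:R = 2 * k%:R + 1 :> R by rewrite natrD natrM.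
  have [_ n2 _ n4] := shifted_pole_bounds b0 bpi (ler0n _ k) (lexx _).
  apply: le_trans (normcD_le _ _) _.
  by rewrite [leRHS]mulr_natl [leRHS]mulr2n; apply: lerD; apply: pole_le; rewrite ?k2 ?kS.
have inv_le k : (pole_dist a b k ^+ 2)^-1 <= (k.+1%:R ^+ 2)^-1 / b ^+ 2.
  rewrite -invfM -exprMn lef_pV2 ?posrE ?exprn_gt0//.
  by apply: lerXn2r => //; rewrite nnegrE ltW.
have -> : (- w) ^- m.+3 + (- Complex (- a) (b - 2 * pi)) ^- m.+3 = g 0%N.
  rewrite /g /pole mulr0 mulr1; congr ((- _) ^- _ + (- _) ^- _).
    by rewrite /w -[RHS]/(Complex _ _) !addr0.
  by rewrite /w -[RHS]/(Complex _ _) addr0.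
(* From this rank on, the real part of [w / 2^(N+1)] is in [-1, 0). *)
pose N0 := Num.bound a.
apply: (@le_of_le_add_pow2 _ _ _ (C * (b ^- m.+2 * 2)) N0) => [|N N0N].
  by rewrite !mulr_ge0// invr_ge0 exprn_ge0// ltW.
have aN : a <= 2 ^+ N.+1.
  apply: (ltW (lt_le_trans (archi_boundP (ltW a0)) _)).
  rewrite -natrX ler_nat (leq_trans (ltnW (ltn_expl _ (isT : 1 < 2)%N)))//.
  by rewrite leq_exp2l// ltnW// ltnS.
have := polylog_partial_poles a0 b0 bpi C0 polylogC aN.
rewrite -/w -/f; set S := \sum_(0 <= k < _) _ => main.
(* The two nearest poles are the ones of index [k = 0]. *)
have SE : S = g 0%N + \sum_(1 <= k < 2 ^ N) g k.
  by rewrite /S big_ltn// expn_gt0.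
set T := \sum_(1 <= k < 2 ^ N) g k in SE.
have -> : f - m.+2`!%:R * g 0%N = (f - m.+2`!%:R * S) + m.+2`!%:R * T.
  by rewrite SE; ring.
apply: le_trans (normcD_le _ _) _; rewrite addrC; apply: lerD.
  rewrite normcM normc_nat ler_wpM2l//.
  apply: le_trans (normc_sum_le _ _ _) _.
  apply: (@le_trans _ _ (\sum_(1 <= k < 2 ^ N)
      2 / b ^+ 2 * pole_dist a b 1 ^- m.+1 * (k.+1%:R ^+ 2)^-1)).
    rewrite big_nat_cond [leRHS]big_nat_cond.
    apply: ler_sum => k /andP[/andP[k1 _] _].
    apply: le_trans (g_le k) _; rewrite -!mulrA ler_wpM2l//.
    have -> : m.+3 = (m.+1 + 2)%N by rewrite addn2.
    rewrite exprD invfM mulrCA.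
    rewrite ler_pM ?invr_ge0 ?exprn_ge0 ?(ltW (h0 _))//.
      rewrite lef_pV2 ?posrE ?exprn_gt0//.
      by apply: lerXn2r; [rewrite nnegrE ltW|rewrite nnegrE ltW|exact: pole_dist_mono].
    by rewrite mulrC; exact: inv_le.
  rewrite -mulr_sumr ler_piMr//.
    by rewrite !mulr_ge0// ?invr_ge0 ?exprn_ge0// ltW.
  have := @sum_inv_sqr_le R (2 ^ N).
  rewrite big_ltn ?expn_gt0// expr1n invr1 => H.
  by rewrite -(lerD2l 1); apply: le_trans H _; lra.
apply: le_trans main _.
have -> : C * (b ^- m.+2 * 2) / 2 ^+ N = C / 2 ^+ N.+1 * (2 * (b ^- m.+2 * 2)).
  rewrite (exprS 2); move: (b ^- _) => q; field.
  by rewrite expf_neq0.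
rewrite ler_wpM2l ?divr_ge0 ?exprn_ge0// -mulr_sumr ler_wpM2l//.
apply: (@le_trans _ _ (\sum_(0 <= k < 2 ^ N) b ^- m.+2 * (k.+1%:R ^+ 2)^-1)).
  apply: ler_sum => k _; rewrite -invfM.
  have hp : 0 < pole_dist a b k ^+ m.+2 by exact: exprn_gt0.
  have bp : 0 < b ^+ m.+2 by exact: exprn_gt0.
  have kp : 0 < k.+1%:R ^+ 2 :> R by exact: exprn_gt0.
  rewrite lef_pV2 ?posrE ?hp ?(mulr_gt0 bp kp)//.
  apply: (@le_trans _ _ ((k.+1%:R * b) ^+ m.+2)).
    rewrite exprMn mulrC; apply: ler_wpM2r; first exact: ltW.
    by apply: ler_weXn2l => //; rewrite ler1n.
  by apply: lerXn2r => //; rewrite nnegrE ltW.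
by rewrite -mulr_sumr ler_wpM2l ?sum_inv_sqr_le// invr_ge0 exprn_ge0// ltW.
Qed.

(** * Dominance of the nearest poles *)

Lemma de_moivre_conj (R : realType) (t : R) M :
  Complex (cos t) (- sin t) ^+ M = Complex (cos (M%:R * t)) (- sin (M%:R * t)).
Proof.
elim: M => [|M IH]; first by rewrite expr0 mul0r cos0 sin0 oppr0.
rewrite exprS IH -natr1 mulrDl mul1r cosD sinD.
by apply/eqP; rewrite eq_complex /=; apply/andP; split; apply/eqP; ring.
Qed.

(** Polar form of the pole part: [b tan t - i b] has modulus [b / cos t] and
    argument [t - pi / 2]. *)
Lemma pole_pow (R : realType) (b t : R) M : b != 0 -> cos t != 0 ->
  Complex (b * tan t) (- b) ^- M = real_complex R ((cos t / b) ^+ M) *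
    (Complex 0 1 ^+ M * Complex (cos (M%:R * t)) (- sin (M%:R * t))).
Proof.
move=> b0 c0; rewrite -exprVn -de_moivre_conj rmorphXn -!exprMn; congr (_ ^+ _).
apply: (@mulfI _ (Complex (b * tan t) (- b))).
  by rewrite eq_complex /= negb_and oppr_eq0 b0 orbT.
rewrite divff; last by rewrite eq_complex /= negb_and oppr_eq0 b0 orbT.
have := cos2Dsin2 t; rewrite /tan => cs.
apply/eqP; rewrite eq_complex /=; apply/andP; split; apply/eqP.
  rewrite !(mul0r, mulr0, subr0, sub0r, addr0, add0r, mul1r, mulr1).
  by rewrite -[LHS]cs; field; rewrite b0 c0.
rewrite !(mul0r, mulr0, subr0, sub0r, addr0, add0r, mul1r, mulr1).
by field; rewrite b0 c0.
Qed.

Lemma i_pow_even (R : rcfType) n :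
  Complex 0 1 ^+ (2 * n) = real_complex R ((-1) ^+ n).
Proof.
by rewrite exprM sqr_i rmorphXn rmorphN rmorph1.
Qed.

Lemma sign_of_close (R : realDomainType) (s A x : R) :
  `|s| = 1 -> `|x - s * A| < A -> 0 < s * x.
Proof.
move=> s1 xA; have ss : s * s = 1 by rewrite -expr2 -real_normK ?num_real// s1 expr1n.
have -> : s * x = A + s * (x - s * A) by rewrite mulrBr mulrA ss mul1r; ring.
have : `|s * (x - s * A)| < A by rewrite normrM s1 mul1r.
by rewrite ltr_norml => /andP[+ _]; lra.
Qed.

Section DominantPole.
Variables (R : realType) (m : nat) (b t : R).
Hypotheses (b0 : 0 < b) (bpi : b <= pi) (t0 : 0 < t) (tpi2 : t < pi / 2).
Let a := b * tan t.
Let h := pole_dist a b 1.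
Let r := b / cos t.
Hypothesis small : 3 * (r / h) ^+ m.+1 < cos t ^+ 2.

Let cost : 0 < cos t.
Proof.
by apply: cos_gt0_pihalf; rewrite tpi2 andbT (lt_trans _ t0)// oppr_lt0 divr_gt0 ?pi_gt0.
Qed.

Let a0 : 0 < a.
Proof.
rewrite mulr_gt0// divr_gt0// sin_gt0_pi// t0/=.
by apply: (lt_le_trans tpi2); rewrite ler_pdivrMr// ler_peMr ?pi_ge0// ler1n.
Qed.

Let r0 : 0 < r. Proof. exact: divr_gt0. Qed.

Let h0 : 0 < h. Proof. exact: pole_dist_gt0. Qed.

Let rE : r ^+ 2 = a ^+ 2 + b ^+ 2.
Proof.
have := cos2Dsin2 t; rewrite /r /a /tan => cs.
have -> : (b / cos t) ^+ 2 = b ^+ 2 * (cos t ^+ 2 + sin t ^+ 2) / cos t ^+ 2.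
  by rewrite cs; field; rewrite gt_eqF.
by field; rewrite gt_eqF.
Qed.

Let rh : r <= h.
Proof.
have : r ^+ 2 <= h ^+ 2.
  by rewrite rE pole_dist_sqr; have := sqr_ge0 b; rewrite /=; lra.
by rewrite ler_pXn2r// nnegrE; exact: ltW.
Qed.

Let far : 3 * h ^- m.+1 < cos t ^+ 2 * r ^- m.+1.
Proof.
have -> : 3 * h ^- m.+1 = 3 * (r / h) ^+ m.+1 * r ^- m.+1.
  rewrite expr_div_n; field.
  by rewrite !expf_neq0 ?gt_eqF.
by rewrite ltr_pM2r// invr_gt0 exprn_gt0.
Qed.

Let tail_bound : 2 / b ^+ 2 * h ^- m.+1 < 2 / 3 * r ^- m.+3.
Proof.
have -> : 2 / 3 * r ^- m.+3 = 2 / 3 / b ^+ 2 * (cos t ^+ 2 * r ^- m.+1).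
  rewrite (_ : r ^+ m.+3 = r ^+ 2 * r ^+ m.+1); last by rewrite -exprD.
  rewrite invfM; move: (r ^- m.+1) => q; rewrite /r.
  by field; rewrite !gt_eqF.
have -> : 2 / b ^+ 2 * h ^- m.+1 = 2 / 3 / b ^+ 2 * (3 * h ^- m.+1).
  by move: (h ^- _) => q; field; rewrite gt_eqF.
by rewrite ltr_pM2l// divr_gt0// exprn_gt0.
Qed.

Let far_pole : h ^- m.+3 < 1 / 3 * r ^- m.+3.
Proof.
have X3 (z : R) : z ^+ m.+3 = z ^+ m.+1 * z ^+ 2 by rewrite -exprD addn2.
rewrite !X3 [(h ^+ _ * _)^-1]invfM [(r ^+ _ * _)^-1]invfM mulrA.
have i1 : h ^- m.+1 < 1 / 3 * r ^- m.+1.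
  have c1 : cos t ^+ 2 <= 1 by have := cos2Dsin2 t; have := sqr_ge0 (sin t); lra.
  have : cos t ^+ 2 * r ^- m.+1 <= r ^- m.+1.
    by rewrite ler_piMl// invr_ge0 exprn_ge0// ltW.
  by have := far; lra.
have i2 : h ^- 2 <= r ^- 2.
  by rewrite lef_pV2 ?posrE ?exprn_gt0// lerXn2r// nnegrE ltW.
have h2 : 0 < h ^- 2 by rewrite invr_gt0 exprn_gt0.
apply: (@lt_le_trans _ _ (1 / 3 * r ^- m.+1 * h ^- 2)); first by rewrite ltr_pM2r.
by rewrite ler_wpM2l// mulr_ge0// invr_ge0 exprn_ge0// ltW.
Qed.

(** For [b = pi] the two nearest poles are conjugate as seen from [w], so they add
    up to twice a real part. *)
Lemma Re_polylog_near_pi : b = pi ->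
  `|complex.Re (polylog m.+2 (Complex (- a) b)) / m.+2`!%:R
     - 2 * complex.Re (Complex a (- b) ^- m.+3)| < 2 * r ^- m.+3.
Proof.
move=> bE; have := polylog_two_poles m a0 b0 bpi.
set f := polylog _ _; set p := (- Complex (- a) b) ^- m.+3.
have -> : (- Complex (- a) (b - 2 * pi)) ^- m.+3 = conjc p.
  have -> : - Complex (- a) (b - 2 * pi) = conjc (- Complex (- a) b).
    by apply/eqP; rewrite eq_complex /= eqxx/= bE; apply/eqP; ring.
  by rewrite /p conjc_inv rmorphXn.
have -> : Complex a (- b) ^- m.+3 = p.
  by rewrite /p; congr (_ ^- _); rewrite /= -[RHS]/(Complex _ _) opprK.
have f0 : 0 < m.+2`!%:R :> R by rewrite ltr0n fact_gt0.
move=> H; have := le_trans (Re_le_normc _) H.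
have -> : complex.Re (f - m.+2`!%:R * (p + conjc p)) =
    m.+2`!%:R * (complex.Re f / m.+2`!%:R - 2 * complex.Re p).
  rewrite -(rmorph_nat (real_complex R)); case: f p {H} => [x y] [c d] /=.
  by field; rewrite gt_eqF.
rewrite normrM gtr0_norm// ler_pM2l// => {}H.
apply: le_lt_trans H _; apply: lt_le_trans tail_bound _.
by rewrite ler_wpM2r ?invr_ge0 ?exprn_ge0 ?(ltW r0)//; lra.
Qed.

(** For [b = pi / 2] only one pole is nearest; the second one is at distance [h],
    three times as high, and is absorbed in the error. *)
Lemma Im_polylog_near_half_pi : b = pi / 2 ->
  `|complex.Im (polylog m.+2 (Complex (- a) b)) / m.+2`!%:R
     - complex.Im (Complex a (- b) ^- m.+3)| < r ^- m.+3.
Proof.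
move=> bE; have := polylog_two_poles m a0 b0 bpi.
set f := polylog _ _; set p := (- Complex (- a) b) ^- m.+3.
set p' := (- Complex (- a) (b - 2 * pi)) ^- m.+3.
have -> : Complex a (- b) ^- m.+3 = p.
  by rewrite /p; congr (_ ^- _); rewrite /= -[RHS]/(Complex _ _) opprK.
have np' : normc p' = h ^- m.+3.
  rewrite /p' normcV normcX; congr (_ ^- _); rewrite /h /pole_dist.
  rewrite /= opprK; congr (Num.sqrt (_ + _ ^+ 2)).
  by rewrite bE; field.
have f0 : 0 < m.+2`!%:R :> R by rewrite ltr0n fact_gt0.
move=> H; have := le_trans (Im_le_normc _) H.
have -> : complex.Im (f - m.+2`!%:R * (p + p')) =
    m.+2`!%:R * (complex.Im f / m.+2`!%:R - complex.Im p - complex.Im p').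
  rewrite -(rmorph_nat (real_complex R)); case: f p p' {H np'} => [x y] [c d] [u v] /=.
  by field; rewrite gt_eqF.
rewrite normrM gtr0_norm// ler_pM2l// => {}H.
have p'le := Im_le_normc p'.
set X := complex.Im f / _ - complex.Im p in H *.
have -> : X = (X - complex.Im p') + complex.Im p' by rewrite subrK.
apply: le_lt_trans (ler_normD _ _) _; apply: le_lt_trans (lerD H p'le) _.
by rewrite np'; have := tail_bound; have := far_pole; rewrite -/h; lra.
Qed.
End DominantPole.

(** Here [e^w = - u], and the polylogarithm is real. *)
Lemma polylog_at_pi (R : realType) m (L : R) (u := expR (- L)) :
  polylog m.+1 (Complex (- L) pi) =
  real_complex R (- u * (eulerian_poly R 1 m).[- u] / (1 + u) ^+ m.+2).
Proof.
have -> : - u * (eulerian_poly R 1 m).[- u] = (polylog_num R m.+1).[- u].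
  by rewrite polylog_numE hornerM hornerX.
rewrite /polylog; have -> : cexp (Complex (- L) pi) = real_complex R (- u).
  by rewrite /cexp /= cospi sinpi mulr0 mulrN1.
rewrite -(map_polylog_num (real_complex R)) horner_map/=.
by rewrite fmorph_div rmorphXn rmorphD rmorph1 rmorphN opprK.
Qed.

(** Here [z = e^w] is [i v], so [z^2] is real and the even and odd parts in
    [polylog_num_even_odd] are the real and imaginary parts. *)
Lemma Im_polylog_at_half_pi (R : realType) m (l : R) (v := expR (- l)) :
  complex.Im (polylog m (Complex (- l) (pi / 2))) =
  v * (eulerian_poly R 2 m).[- v ^+ 2] / (1 + v ^+ 2) ^+ m.+1.
Proof.
have v0 : 0 < v by exact: expR_gt0.
set w := Complex _ _; set z : R[i] := Complex 0 v.
have wz : cexp w = z by rewrite /cexp /= cos_pihalf sin_pihalf mulr0 mulr1.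
have zz : z ^+ 2 = real_complex R (- v ^+ 2).
  by apply/eqP; rewrite eq_complex /=; apply/andP; split; apply/eqP; ring.
have E : polylog m w = ((polylog_num R[i] m).[z] * (1 + z) ^+ m.+1) / (1 - z ^+ 2) ^+ m.+1.
  have z1 : 1 + z != 0 by rewrite eq_complex /= negb_and addr0 oner_eq0.
  rewrite /polylog wz (_ : 1 - z ^+ 2 = (1 - z) * (1 + z)); last by ring.
  by rewrite exprMn -mulf_div divff ?mulr1// expf_neq0.
have /(congr1 (fun y => y / (1 - z ^+ 2) ^+ m.+1)) := horner_polylog_num_even_odd m z.
rewrite -E zz -(map_polylog_num (real_complex R)).
rewrite -(map_eulerian_poly (real_complex R)) !horner_map/=.
have -> : 1 - real_complex R (- v ^+ 2) = real_complex R (1 + v ^+ 2).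
  by rewrite rmorphN opprK rmorphD rmorph1.
rewrite -(rmorph_nat (real_complex R)) -!rmorphXn -fmorphV => ->.
move: (_.[_]) (_.[_]) (_ ^+ m.+1)^-1 (2 ^+ m) => A G q e.
by rewrite /= !(mul0r, mulr0, add0r, addr0, subr0).
Qed.

(** The ratio of the distances to the nearest and to the next poles has square
    [(1 + tan^2 t) / (9 + tan^2 t)], bounded away from [1] when [t] is bounded away
    from [pi / 2]. *)
Lemma small_pole_ratio (R : realType) (tm : R) : 0 < tm -> tm < pi / 2 ->
  exists K, forall k (t b : R), (K <= k)%N -> 0 < t -> t <= tm -> 0 < b ->
    3 * (b / cos t / pole_dist (b * tan t) b 1) ^+ k < cos t ^+ 2.
Proof.
move=> tm0 tmpi.
have pi2 : 0 < pi / 2 :> R by rewrite divr_gt0 ?pi_gt0.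
have itv t : 0 < t -> t <= tm -> t \in `](- (pi / 2)), (pi / 2)[.
  move=> t0 tt; rewrite in_itv/= (lt_trans _ t0) ?oppr_lt0//.
  exact: le_lt_trans tmpi.
have cosp t : 0 < t -> t <= tm -> 0 < cos t.
  by move=> t0 tt; apply: cos_gt0_pihalf; have := itv t t0 tt; rewrite in_itv.
pose T := tan tm; pose Q := (1 + T ^+ 2) / (9 + T ^+ 2).
have T2 := sqr_ge0 T.
have d9 : 0 < 9 + T ^+ 2 by lra.
have Q0 : 0 < Q by rewrite divr_gt0//; lra.
have Q1 : Q < 1 by rewrite ltr_pdivrMr// mul1r; lra.
pose q := Num.sqrt Q.
have q0 : 0 <= q by exact: sqrtr_ge0.
have q1 : q < 1 by rewrite -sqrtr1 ltr_sqrt.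
have ctm := cosp tm tm0 (lexx _).
have : geometric 3 q @ \oo --> 0 by apply: cvg_geometric; rewrite ger0_norm.
move=> /cvgr_lt/(_ (cos tm ^+ 2))/(_ (exprn_gt0 _ ctm))[K _ HK].
exists K => k t b Kk t0 tt b0; have ct := cosp t t0 tt.
set r := b / cos t; set h := pole_dist _ _ _.
have r0 : 0 < r by rewrite divr_gt0.
have tant : 0 < tan t.
  rewrite divr_gt0// sin_gt0_pi// t0/= (le_lt_trans tt)// (lt_trans tmpi)//.
  by rewrite ltr_pdivrMr// ltr_pMr ?pi_gt0// ltr1n.
have h0 : 0 < h by rewrite pole_dist_gt0// mulr_gt0.
have tanle : tan t <= T.
  move: tt; rewrite le_eqVlt => /predU1P[-> //|ttm].
  by rewrite ltW// ltr_tan// itv// ltW.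
have rhQ : (r / h) ^+ 2 <= Q.
  have cs := cos2Dsin2 t.
  have -> : (r / h) ^+ 2 = (1 + tan t ^+ 2) / (9 + tan t ^+ 2).
    have -> : 1 + tan t ^+ 2 = (cos t ^+ 2)^-1.
      by rewrite -cos2_tan2// gt_eqF.
    have he : h ^+ 2 = b ^+ 2 * (9 + tan t ^+ 2).
      by rewrite pole_dist_sqr (_ : (2 * 1 + 1)%:R = 3 :> R)//; ring.
    have n9 : 9 + tan t ^+ 2 != 0 by rewrite gt_eqF//; have := sqr_ge0 (tan t); lra.
    rewrite expr_div_n he /r expr_div_n; move: (tan t ^+ 2) n9 => s n9.
    by field; rewrite n9 !gt_eqF.
  rewrite /Q ler_pdivrMr; last by have := sqr_ge0 (tan t); lra.
  rewrite mulrAC ler_pdivlMr//.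
  have T0 : 0 <= T by apply: le_trans tanle; exact: ltW.
  have : tan t ^+ 2 <= T ^+ 2 by rewrite lerXn2r// nnegrE ltW.
  by lra.
have rq : r / h <= q.
  by apply: le_trans (ler_norm _) _; rewrite -sqrtr_sqr ler_wsqrtr.
apply: (@le_lt_trans _ _ (3 * q ^+ k)).
  by rewrite ler_wpM2l// lerXn2r// nnegrE divr_ge0// ltW.
apply: (lt_le_trans (HK k Kk)).
apply: lerXn2r; [by rewrite nnegrE ltW|by rewrite nnegrE ltW|].
move: tt; rewrite le_eqVlt => /predU1P[-> //|ttm].
have tpi : tm <= pi by rewrite ltW// (lt_trans tmpi)// ltr_pdivrMr// ltr_pMr ?pi_gt0// ltr1n.
rewrite ltW// ltr_cos// in_itv/= ltW//=.
by rewrite ltW// (lt_le_trans ttm).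
Qed.

(** At [m + 1 = 2n + 3] the pole part has phase [i^(m+1) e^(- i (m+1) t)], whose
    real part is [sin ((m + 1) t)] up to a sign. *)
Lemma eulerian_poly1_sign (R : realType) n (t : R) : 0 < t -> t < pi / 2 ->
  3 * (pi / cos t / pole_dist (pi * tan t) pi 1) ^+ (2 * n).+1 < cos t ^+ 2 ->
  `|sin ((2 * n.+1).+1%:R * t)| = 1 ->
  0 < (-1) ^+ n * sin ((2 * n.+1).+1%:R * t) *
    (eulerian_poly R 1 (2 * n).+1).[- expR (- (pi * tan t))].
Proof.
move=> t0 tpi small s1; have pi0 := pi_gt0 R.
have c0 : 0 < cos t.
  by apply: cos_gt0_pihalf; rewrite tpi andbT (lt_trans _ t0)// oppr_lt0 divr_gt0.
have := Re_polylog_near_pi pi0 (lexx _) t0 tpi small erefl.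
have -> : (2 * n).+3 = (2 * n.+1).+1 by rewrite mulnS.
rewrite polylog_at_pi pole_pow ?gt_eqF//.
move: s1; set M := (2 * n.+1).+1; set S := sin _ => s1.
set u := expR _; set G := _.[_]; set A := (cos t / pi) ^+ M.
have AE : (pi / cos t) ^- M = A by rewrite -exprVn invf_div.
have -> : complex.Re (real_complex R A * (Complex 0 1 ^+ M *
    Complex (cos (M%:R * t)) (- S))) = A * ((-1) ^+ n.+1 * S).
  by rewrite {2}/M (exprS (Complex 0 1)) i_pow_even /=; ring.
rewrite AE /= => H.
have u0 : 0 < u by exact: expR_gt0.
have s1' : `|(-1) ^+ n.+1 * S| = 1 by rewrite normrM normrX normrN1 expr1n mul1r.
have := sign_of_close s1' (_ : `|_ - _ * (2 * A)| < 2 * A).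
move=> /(_ (- u * G / (1 + u) ^+ (2 * n).+3 / (2 * n).+2`!%:R)).
rewrite (_ : (-1) ^+ n.+1 * S * (2 * A) = 2 * (A * ((-1) ^+ n.+1 * S))); last by ring.
move=> /(_ H); set D := (1 + u) ^+ _; set f := _`!%:R.
have D0 : 0 < D by rewrite exprn_gt0// addr_gt0.
have f0 : 0 < f by rewrite ltr0n fact_gt0.
rewrite (_ : _ * _ = u / D / f * ((-1) ^+ n * S * G)); last by rewrite exprS; ring.
by rewrite pmulr_rgt0// !divr_gt0.
Qed.

(** At [m + 1 = 2n + 4] the factor [i^(m+1)] is real, and the sine appears in the
    imaginary part. *)
Lemma eulerian_poly2_sign (R : realType) n (t : R) : 0 < t -> t < pi / 2 ->
  3 * (pi / 2 / cos t / pole_dist (pi / 2 * tan t) (pi / 2) 1) ^+ (2 * n).+2 <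
    cos t ^+ 2 ->
  `|sin ((2 * n.+2)%:R * t)| = 1 ->
  0 < (-1) ^+ n.+1 * sin ((2 * n.+2)%:R * t) *
    (eulerian_poly R 2 (2 * n).+3).[- expR (- (pi * tan t))].
Proof.
move=> t0 tpi small s1; have pi0 := pi_gt0 R.
have pi20 : 0 < pi / 2 :> R by rewrite divr_gt0.
have pi2le : pi / 2 <= pi :> R by rewrite ler_pdivrMr// ler_peMr ?ler1n// ltW.
have c0 : 0 < cos t.
  by apply: cos_gt0_pihalf; rewrite tpi andbT (lt_trans _ t0)// oppr_lt0.
have := Im_polylog_near_half_pi pi20 pi2le t0 tpi small erefl.
have -> : (2 * n).+4 = (2 * n.+2)%N by rewrite !mulnS.
rewrite Im_polylog_at_half_pi pole_pow ?gt_eqF//.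
move: s1; set M := (2 * n.+2)%N; set S := sin _ => s1.
set v := expR _; set A := (cos t / (pi / 2)) ^+ M.
have -> : expR (- (pi * tan t)) = v ^+ 2.
  by rewrite expr2 -expRD; congr expR; field.
set G := _.[_].
have AE : (pi / 2 / cos t) ^- M = A by rewrite -exprVn invf_div.
have -> : complex.Im (real_complex R A * (Complex 0 1 ^+ M *
    Complex (cos (M%:R * t)) (- S))) = - (-1) ^+ n.+2 * S * A.
  by rewrite i_pow_even /=; ring.
rewrite AE => H.
have v0 : 0 < v by exact: expR_gt0.
have s1' : `|- (-1) ^+ n.+2 * S| = 1.
  by rewrite normrM normrN normrX normrN1 expr1n mul1r.
have := sign_of_close s1' H.
set D := (1 + _) ^+ _; set f := _`!%:R.
have D0 : 0 < D by rewrite exprn_gt0// addr_gt0// exprn_gt0.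
have f0 : 0 < f by rewrite ltr0n fact_gt0.
have -> : - (-1) ^+ n.+2 * S * (v * G / D / f) = v / D / f * ((-1) ^+ n.+1 * S * G).
  by rewrite (exprS (-1) n.+1); ring.
by rewrite pmulr_rgt0// !divr_gt0.
Qed.

(** * Signs of the two polynomials at the quantiles of the limit *)

(** The point [tanh (L / 2) ^ 2] with [L = pi * tan t]. *)
Definition angle_point (R : realType) (t : R) : R :=
  ((1 - expR (- (pi * tan t))) / (1 + expR (- (pi * tan t)))) ^+ 2.

(** With [x = (1 - u) / (1 + u)], the quotient of [x - 1] by [1 + x] is [- u]. *)
Lemma cayley_eulerian_poly (R : realType) c n (u : R) : (0 < n)%N -> 0 < u ->
  \sum_(0 <= k < 2 * n) (eulerian_poly R c (2 * n - 1))`_k *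
     ((1 - u) / (1 + u) - 1) ^+ k * (1 + (1 - u) / (1 + u)) ^+ (2 * n - 1 - k) =
  (2 / (1 + u)) ^+ (2 * n - 1) * (eulerian_poly R c (2 * n - 1)).[- u].
Proof.
move=> n0 u0; have up : 1 + u != 0 by rewrite gt_eqF// addr_gt0.
have s : (size (eulerian_poly R c (2 * n - 1)) <= 2 * n)%N.
  by apply: leq_trans (size_eulerian_poly _ _ _) _; lia.
rewrite (horner_coef_wide _ s) big_mkord mulr_sumr; apply: eq_bigr => k _.
have -> : (1 - u) / (1 + u) - 1 = 2 / (1 + u) * (- u) by field.
have -> : 1 + (1 - u) / (1 + u) = 2 / (1 + u) by field.
have -> : (2 / (1 + u)) ^+ (2 * n - 1) =
    (2 / (1 + u)) ^+ k * (2 / (1 + u)) ^+ (2 * n - 1 - k).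
  by rewrite -exprD subnKC//; have := ltn_ord k; lia.
by rewrite exprMn; ring.
Qed.

Lemma Xi_tilde_horner (R : realType) n (u : R) : (0 < n)%N -> 0 < u < 1 ->
  let x := (1 - u) / (1 + u) in
  2 * x * (Xi_tilde R n).[x ^+ 2] =
  (-1) ^+ n.+1 / (2 ^+ (4 * n - 2) * (2 * n - 1)`!%:R) *
    ((2 / (1 + u)) ^+ (2 * n - 1) * (eulerian_poly R 2 (2 * n - 1)).[- u]).
Proof.
move=> n0 /andP[u0 u1] x; rewrite -(@cayley_eulerian_poly R 2 n u n0 u0) -/x.
rewrite -(@central_sum_palindromic R _ x n n0); last first.
  by move=> k kn; rewrite eulerian_poly_palindromic//; lia.
rewrite Xi_tildeE hornerZ horner_sum mulrCA; congr (_ * (_ * _)).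
apply: eq_bigr => t _; rewrite hornerZ hornerXn -exprM; congr (_ * _).
by rewrite /calCB /eulerianB eulerianB_eulerian_poly.
Qed.

Lemma Lambda_tilde_horner (R : realType) n (u : R) : (0 < n)%N -> 0 < u < 1 ->
  let x := (1 - u) / (1 + u) in
  2 * x * (Lambda_tilde R n).[x ^+ 2] =
  2 * (-1) ^+ n.+1 / ((2 ^+ (2 * n).+1 - 1) * (2 * n)`!%:R) *
    ((2 / (1 + u)) ^+ (2 * n - 1) * (eulerian_poly R 1 (2 * n - 1)).[- u]).
Proof.
move=> n0 /andP[u0 u1] x; rewrite -(@cayley_eulerian_poly R 1 n u n0 u0) -/x.
rewrite -(@central_sum_palindromic R _ x n n0); last first.
  by move=> k kn; rewrite eulerian_poly_palindromic//; lia.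
rewrite Lambda_tildeE hornerZ horner_sum mulrCA; congr (_ * (_ * _)).
apply: eq_bigr => t _; rewrite hornerZ hornerXn -exprM; congr (_ * _).
rewrite /calCA; apply: eq_bigr => k _; congr (_ * _ * _).
by rewrite -eulerianA_eulerian_poly; congr (eulerianA _ _)%:R; lia.
Qed.

Section AnglePoint.
Variable R : realType.
Implicit Types t x : R.

Let half_pi_itv t : 0 < t -> t < pi / 2 -> t \in `](- (pi / 2)), (pi / 2)[.
Proof.
by move=> t0 tp; rewrite in_itv/= tp andbT (lt_trans _ t0)// oppr_lt0 divr_gt0 ?pi_gt0.
Qed.

Lemma expR_tan_itv t : 0 < t -> t < pi / 2 -> 0 < expR (- (pi * tan t)) < 1.
Proof.
move=> t0 tp; rewrite expR_gt0 expR_lt1 oppr_lt0 mulr_gt0 ?pi_gt0//.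
rewrite divr_gt0//; last first.
  by apply: cos_gt0_pihalf; have := half_pi_itv t0 tp; rewrite in_itv.
rewrite sin_gt0_pi// t0/= (lt_trans tp)// ltr_pdivrMr// ltr_pMr ?pi_gt0//.
by rewrite ltr1n.
Qed.

Lemma cayley_itv (u : R) : 0 < u < 1 -> 0 < (1 - u) / (1 + u) < 1.
Proof.
move=> /andP[u0 u1]; rewrite divr_gt0 ?ltr_pdivrMr ?mul1r; [|lra..].
by lra.
Qed.

Lemma angle_point_itv t : 0 < t -> t < pi / 2 -> 0 < angle_point t < 1.
Proof.
move=> t0 tp; have /andP[c0 c1] := cayley_itv (expR_tan_itv t0 tp).
by rewrite exprn_gt0//= exprn_ilt1 ?ltW.
Qed.

Lemma angle_point_incr t t' : 0 < t -> t < t' -> t' < pi / 2 ->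
  angle_point t < angle_point t'.
Proof.
move=> t0 tt tp; have t0' := lt_trans t0 tt; have tp' := lt_trans tt tp.
have e := expR_tan_itv t0 tp'; have e' := expR_tan_itv t0' tp.
have : expR (- (pi * tan t')) < expR (- (pi * tan t)).
  by rewrite ltr_expR ltrN2 ltr_pM2l ?pi_gt0// ltr_tan// half_pi_itv.
rewrite /angle_point; have /andP[c0 _] := cayley_itv e; have /andP[c0' _] := cayley_itv e'.
move: (expR _) (expR _) e e' c0 c0' => u v /andP[u0 u1] /andP[v0 v1] c0 c0' vu.
rewrite ltr_pXn2r// ?nnegrE ?ltW// ltr_pdivrMr; last by lra.
by rewrite mulrAC ltr_pdivlMr; nra.
Qed.

(** [angle_point t] is the quantile of order [2 t / pi] of the limit: inverting
    [x = tanh (L / 2) ^ 2] and [L = pi * tan t] gives the formula of [limit_cdf]. *)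
Lemma limit_cdf_angle x : 0 < x < 1 ->
  let t := pi / 2 * limit_cdf x in
  [/\ 0 < t, t < pi / 2 & angle_point t = x].
Proof.
move=> /andP[x0 x1] t; have pi0 := pi_gt0 R.
have s0 : 0 < Num.sqrt x by rewrite sqrtr_gt0.
have s1 : Num.sqrt x < 1 by rewrite -sqrtr1 ltr_sqrt.
pose q := (1 + Num.sqrt x) / (1 - Num.sqrt x).
have q1 : 1 < q by rewrite ltr_pdivlMr ?mul1r; lra.
have lq : 0 < ln q by rewrite ln_gt0.
have tE : t = atan (ln q / pi).
  rewrite /t /limit_cdf leNgt x0/= x1 -/q mul1r (mulrC _ (ln q)) mulrA.
  by rewrite -invf_div mulVf ?mul1r// gt_eqF// divr_gt0.
have tant : pi * tan t = ln q.
  by rewrite tE atanK mulrC divfK// gt_eqF.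
split; first by rewrite tE -(@atan0 R) lt_atan// divr_gt0.
  by rewrite tE atan_ltpi2.
rewrite /angle_point tant expRN lnK ?posrE; last by lra.
rewrite -[RHS]sqr_sqrtr ?(ltW x0)//; congr (_ ^+ 2).
by rewrite /q; field; rewrite !gt_eqF//; lra.
Qed.

Lemma limit_cdf_le0 x : x <= 0 -> limit_cdf x = 0.
Proof. by rewrite /limit_cdf => ->. Qed.

Lemma limit_cdf_ge1 x : 1 <= x -> limit_cdf x = 1.
Proof.
by move=> x1; rewrite /limit_cdf leNgt (lt_le_trans ltr01 x1)/= ltNge x1.
Qed.

Lemma limit_cdf_itv x : 0 <= limit_cdf x <= 1.
Proof.
have [x0|x0] := leP x 0; first by rewrite limit_cdf_le0// lexx ler01.
have [x1|x1] := ltP x 1; last by rewrite limit_cdf_ge1// lexx ler01.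
have [|t0 tp _] := @limit_cdf_angle x; first by rewrite x0 x1.
have p2 : 0 < pi / 2 :> R by rewrite divr_gt0 ?pi_gt0.
by move: t0 tp; rewrite pmulr_rgt0// -ltr_pdivlMl// mulVf ?gt_eqF// => /ltW -> /ltW ->.
Qed.

Lemma angle_point_le t x : 0 < t -> t < pi / 2 -> t <= pi / 2 * limit_cdf x ->
  angle_point t <= x.
Proof.
move=> t0 tp; have /andP[y0 y1] := angle_point_itv t0 tp.
have [x0|x0] := leP x 0.
  by rewrite limit_cdf_le0// mulr0 leNgt t0.
have [x1|x1 _] := ltP x 1; last by apply: le_trans x1; exact: ltW.
have [|s0 sp sx] := @limit_cdf_angle x; first by rewrite x0 x1.
rewrite le_eqVlt => /predU1P[->|ts]; first by rewrite sx.
by rewrite -sx ltW// angle_point_incr.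
Qed.

(** Together with [angle_point_le], this states that [angle_point t <= x] amounts to
    [t <= pi / 2 * limit_cdf x], for every real [x]. *)
Lemma angle_point_gt t x : 0 < t -> t < pi / 2 -> pi / 2 * limit_cdf x < t ->
  x < angle_point t.
Proof.
move=> t0 tp; have /andP[y0 y1] := angle_point_itv t0 tp.
have [x0 _|x0] := leP x 0; first exact: le_lt_trans y0.
have [x1|x1] := ltP x 1; last first.
  by rewrite limit_cdf_ge1// mulr1 ltNge (ltW tp).
have [|s0 sp sx] := @limit_cdf_angle x; first by rewrite x0 x1.
by move=> ts; rewrite -sx angle_point_incr.
Qed.

End AnglePoint.

Lemma sign_of_scaled (R : realFieldType) (s x p c g : R) :
  0 < x -> 0 < c -> 2 * x * p = c * g -> 0 < s * g -> 0 < s * p.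
Proof.
move=> x0 c0 E sg; have : 0 < 2 * x * (s * p).
  by rewrite mulrCA E mulrCA mulr_gt0.
by rewrite pmulr_rgt0// mulr_gt0.
Qed.

(** The sign [(-1)^(n+1)] in the normalisation of [Xi_n] cancels the sign coming
    from the phase of the pole. *)
Lemma Xi_tilde_sign (R : realType) (tm : R) : 0 < tm -> tm < pi / 2 ->
  exists N, forall n t, (N <= n)%N -> 0 < t -> t <= tm ->
    `|sin ((2 * n)%:R * t)| = 1 ->
    0 < sin ((2 * n)%:R * t) * (Xi_tilde R n).[angle_point t].
Proof.
move=> tm0 tmp; have [K HK] := small_pole_ratio tm0 tmp.
exists K.+2 => -[|[|n]]// t; rewrite !ltnS => Kn t0 ttm s1.
have tp := le_lt_trans ttm tmp.
have pi2 : 0 < pi / 2 :> R by rewrite divr_gt0 ?pi_gt0.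
have Kn2 : (K <= (2 * n).+2)%N by lia.
have G := eulerian_poly2_sign t0 tp (HK _ t _ Kn2 t0 ttm pi2) s1.
have u01 := expR_tan_itv t0 tp; have /andP[x0 _] := cayley_itv u01.
have := Xi_tilde_horner (isT : 0 < n.+2)%N u01.
have -> : (2 * n.+2 - 1 = (2 * n).+3)%N by lia.
rewrite /= -/(angle_point t); set u := expR _ in u01 x0 G *.
case/andP: u01 => u0 u1.
set d := 2 ^+ _ * _; set e := (2 / _) ^+ _ => E.
have d0 : 0 < d by rewrite mulr_gt0// ?exprn_gt0// ltr0n fact_gt0.
have e0 : 0 < e by rewrite exprn_gt0// divr_gt0// addr_gt0.
apply: (@sign_of_scaled _ _ ((1 - u) / (1 + u)) _ (e / d)
  ((-1) ^+ n.+1 * (eulerian_poly R 2 (2 * n).+3).[- u])) => //; first exact: divr_gt0.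
  by rewrite E !exprS; ring.
by move: G; rewrite -mulrA mulrCA.
Qed.

Lemma Lambda_tilde_sign (R : realType) (tm : R) : 0 < tm -> tm < pi / 2 ->
  exists N, forall n t, (N <= n)%N -> 0 < t -> t <= tm ->
    `|sin ((2 * n).+1%:R * t)| = 1 ->
    0 < sin ((2 * n).+1%:R * t) * (Lambda_tilde R n).[angle_point t].
Proof.
move=> tm0 tmp; have [K HK] := small_pole_ratio tm0 tmp.
exists K.+1 => -[|n]// t; rewrite !ltnS => Kn t0 ttm s1.
have tp := le_lt_trans ttm tmp.
have Kn2 : (K <= (2 * n).+1)%N by lia.
have G := eulerian_poly1_sign t0 tp (HK _ t _ Kn2 t0 ttm (pi_gt0 R)) s1.
have u01 := expR_tan_itv t0 tp; have /andP[x0 _] := cayley_itv u01.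
have := Lambda_tilde_horner (isT : 0 < n.+1)%N u01.
have -> : (2 * n.+1 - 1 = (2 * n).+1)%N by lia.
rewrite /= -/(angle_point t); set u := expR _ in u01 x0 G *.
case/andP: u01 => u0 u1.
set d := (2 ^+ _ - 1) * _; set e := (2 / _) ^+ _ => E.
have d0 : 0 < d.
  rewrite mulr_gt0// ?ltr0n ?fact_gt0// subr_gt0.
  by rewrite exprn_egt1// ltr1n.
have e0 : 0 < e by rewrite exprn_gt0// divr_gt0// addr_gt0.
apply: (@sign_of_scaled _ _ ((1 - u) / (1 + u)) _ (2 * e / d)
  ((-1) ^+ n * (eulerian_poly R 1 (2 * n).+1).[- u])) => //.
- by rewrite divr_gt0// mulr_gt0.
- by rewrite E !exprS; ring.
- by move: G; rewrite -mulrA mulrCA.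
Qed.

(** * Counting zeros between sign changes *)

Lemma zero_cdfE (R : realType) (p : {poly R}) (x : R) : zero_cdf p x =
  ((count (fun r => r <= x) (rootsR p))%:R / (size p).-1%:R)%:E.
Proof.
rewrite /zero_cdf /zero_measure /mscale/= mulrC EFinM; congr (_ * _)%E.
rewrite /msum/=.
transitivity (\sum_(r <- rootsR p) ((r <= x)%R%:R : R)%:E)%E.
  rewrite (big_nth 0) big_mkord; apply: eq_bigr => i _.
  by rewrite /= /dirac indicE mem_setE in_itv.
by rewrite sumEFin -natr_sum -sum1_count [in RHS]big_mkcond.
Qed.

Lemma mem_rootsR (R : rcfType) (p : {poly R}) r : p != 0 ->
  (r \in rootsR p) = root p r.
Proof. by move=> p0; rewrite -(roots_on_rootsR p0) in_itv. Qed.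

Lemma count_roots_ge (R : rcfType) (p : {poly R}) (a : pred R) (rs : seq R) :
  p != 0 -> uniq rs -> all (root p) rs -> all a rs ->
  (size rs <= count a (rootsR p))%N.
Proof.
move=> p0 urs /allP prs /allP ars; rewrite -size_filter; apply: uniq_leq_size => // r rrs.
by rewrite mem_filter ars// mem_rootsR// prs.
Qed.

Lemma size_rootsR (R : rcfType) (p : {poly R}) : p != 0 ->
  (size (rootsR p) <= (size p).-1)%N.
Proof.
move=> p0; rewrite -ltnS prednK ?size_poly_gt0//.
apply: max_poly_roots => //; last exact: uniq_roots.
by apply/allP => r; rewrite mem_rootsR.
Qed.

Lemma alternating_roots (R : rcfType) (p : {poly R}) (y : nat -> R) J :
  (forall j, (j < J)%N -> y j < y j.+1) ->
  (forall j, (j <= J)%N -> 0 < (-1) ^+ j * p.[y j]) ->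
  exists r : nat -> R, forall j, (j < J)%N -> y j < r j < y j.+1 /\ root p (r j).
Proof.
move=> y_incr alt.
suff : forall j, exists x, (j < J)%N -> y j < x < y j.+1 /\ root p x.
  by move=> /choice[r hr]; exists r.
move=> j; have [jJ|] := ltnP j J; last by exists 0.
have neg : p.[y j] * p.[y j.+1] < 0.
  have := mulr_gt0 (alt j (ltnW jJ)) (alt j.+1 jJ).
  have -> : (-1) ^+ j * p.[y j] * ((-1) ^+ j.+1 * p.[y j.+1]) =
      - ((-1) ^+ j ^+ 2) * (p.[y j] * p.[y j.+1]) by rewrite exprS; ring.
  by rewrite sqrr_sign mulN1r oppr_gt0.
have [x] := poly_ivtoo (ltW (y_incr j jJ)) neg.
by rewrite in_itv/= => xy px; exists x.
Qed.

(** The angles [t] with [M t = pi / 2 + j pi], where [sin (M t)] is [1] or [-1]. *)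
Definition sample_angle (R : realType) (M j : nat) : R :=
  (2 * j + 1)%:R * pi / (2 * M%:R).

Section Nodes.
Variables (R : realType) (p : {poly R}) (M J : nat) (tm : R).
Hypotheses (tmp : tm < pi / 2).
Let node := @sample_angle R M.
Hypotheses (M0 : (0 < M)%N) (nodeJ : sample_angle R M J <= tm).
Hypothesis signs : forall t, 0 < t -> t <= tm -> `|sin (M%:R * t)| = 1 ->
  0 < sin (M%:R * t) * p.[angle_point t].

Let pi0 : 0 < pi :> R := pi_gt0 R.
Let M0' : 0 < M%:R :> R. Proof. by rewrite ltr0n. Qed.

Let node_gt0 j : 0 < node j.
Proof. by rewrite /node /sample_angle divr_gt0 ?mulr_gt0 ?ltr0n// addn1. Qed.

Let node_lt i j : (i < j)%N -> node i < node j.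
Proof.
move=> ij; rewrite /node /sample_angle.
by rewrite ltr_pM2r ?invr_gt0 ?mulr_gt0// ltr_pM2r// ltr_nat; lia.
Qed.

Let node_le i j : (i <= j)%N -> node i <= node j.
Proof. by rewrite leq_eqVlt => /predU1P[->//|/node_lt/ltW]. Qed.

Let node_tm j : (j <= J)%N -> node j <= tm.
Proof. by move=> jJ; apply: le_trans nodeJ; exact: node_le. Qed.

Let node_pi j : (j <= J)%N -> node j < pi / 2.
Proof. by move=> jJ; apply: le_lt_trans (node_tm jJ) tmp. Qed.

Let sin_node j : sin (M%:R * node j) = (-1) ^+ j.
Proof.
have -> : M%:R * node j = pi / 2 + pi *+ j.
  rewrite /node /sample_angle natrD natrM -(mulr_natr _ j); move: (pi : R) => q.
  by field; rewrite gt_eqF.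
by rewrite alternatingn ?sin_pihalf ?mulr1//; exact: sinDpi.
Qed.

Let y j := angle_point (node j).

Let y_lt i j : (i < j)%N -> (j <= J)%N -> y i < y j.
Proof. by move=> ij jJ; apply: angle_point_incr => //; [exact: node_lt|exact: node_pi]. Qed.

Let alt j : (j <= J)%N -> 0 < (-1) ^+ j * p.[y j].
Proof.
move=> jJ; rewrite -sin_node; apply: signs => //; first exact: node_tm.
by rewrite sin_node normrX normrN1 expr1n.
Qed.

Let p0 : p != 0.
Proof. by apply: contraTneq (alt (leq0n J)) => ->; rewrite horner0 mulr0 ltxx. Qed.

(** One zero lies between any two consecutive sample points. *)
Lemma count_roots_between (a : pred R) i k : (i <= k)%N -> (k <= J)%N ->
  (forall r, y i < r < y k -> a r) -> (k - i <= count a (rootsR p))%N.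
Proof.
move=> ik kJ ha.
have [r hr] := alternating_roots (fun j (jJ : (j < J)%N) => y_lt (ltnSn j) jJ) alt.
have y_le u v : (u <= v)%N -> (v <= J)%N -> y u <= y v.
  by rewrite leq_eqVlt => /predU1P[->//|uv vJ]; rewrite ltW// y_lt.
rewrite -[leqLHS](size_iota i) -(size_map r); apply: count_roots_ge => //.
- have r_lt u v : (u < v)%N -> (v < J)%N -> r u < r v.
    move=> uv vJ; have [/andP[_ ru] _] := hr u (ltn_trans uv vJ).
    have [/andP[rv _] _] := hr v vJ.
    by apply: lt_trans ru (le_lt_trans _ rv); rewrite y_le// ltnW.
  rewrite map_inj_in_uniq ?iota_uniq// => u v.
  rewrite !mem_iota => /andP[_ uk] /andP[_ vk] ruv.
  have [uv|vu|//] := ltngtP u v.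
    by have := @r_lt u v uv; rewrite ruv ltxx => H; have := H ltac:(lia).
  by have := @r_lt v u vu; rewrite ruv ltxx => H; have := H ltac:(lia).
- apply/allP => z /mapP[j + ->]; rewrite mem_iota => /andP[_ jk].
  by have [] := hr j ltac:(lia).
- apply/allP => z /mapP[j + ->]; rewrite mem_iota => /andP[ij jk].
  have [/andP[rj1 rj2] _] := hr j ltac:(lia).
  apply: ha; apply/andP; split.
    by apply: le_lt_trans rj1; rewrite y_le//; lia.
  by apply: lt_le_trans rj2 _; rewrite y_le//; lia.
Qed.

(** The zeros found below [x] bound the distribution function from below; those
    found above [x] bound it from above, since the degree bounds the number of all
    zeros. *)
Lemma zero_cdf_bounds n K1 K2 x : (size p <= n.+1)%N -> (0 < J)%N ->
  (K2 <= J)%N ->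
  (0 < K2)%N ==> (sample_angle R M K2 <= pi / 2 * limit_cdf x) ->
  pi / 2 * limit_cdf x < sample_angle R M K1 ->
  exists v : R, [/\ zero_cdf p x = v%:E, v <= 1, K2%:R / n%:R <= v &
    v <= 1 - (J%:R - K1%:R) / n%:R].
Proof.
move=> pn J0 K2J hK2 hK1; rewrite zero_cdfE.
set cnt := count _ _; set d := (size p).-1; exists (cnt%:R / d%:R).
have szd := size_rootsR p0; rewrite -/d in szd.
have Jd : (J <= d)%N.
  apply: leq_trans szd; rewrite -(count_predT (rootsR p)) -{1}(subn0 J).
  exact: count_roots_between.
have d0 : 0 < d%:R :> R by rewrite ltr0n (leq_trans J0).
have dn : (d <= n)%N by rewrite /d; lia.
have n0 : 0 < n%:R :> R by rewrite ltr0n (leq_trans _ dn)// (leq_trans J0).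
pose far := count (predC (fun r : R => r <= x)) (rootsR p).
have cs : (cnt + far = size (rootsR p))%N by exact: count_predC.
have div_le (k : nat) : k%:R / n%:R <= k%:R / d%:R :> R.
  by rewrite ler_wpM2l// lef_pV2 ?posrE// ler_nat.
split=> //.
- by rewrite ler_pdivrMr// mul1r ler_nat; lia.
- apply: le_trans (div_le K2) _; rewrite ler_pM2r ?invr_gt0// ler_nat.
  case: (posnP K2) hK2 => [-> //|K20 /= hK2].
  rewrite -[leqLHS]subn0; apply: count_roots_between => // r /andP[_ ry].
  by apply: (le_trans (ltW ry)); apply: angle_point_le => //; exact: node_pi.
- have far_ge : (J - K1 <= far)%N.
    have [JK|KJ] := leqP J K1; first by rewrite (eqP JK : J - K1 = 0)%N.
    apply: count_roots_between => [||r /andP[yr _]]//; first exact: ltnW.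
    rewrite /= -ltNge; apply: lt_trans yr; apply: angle_point_gt => //.
    by apply: node_pi; exact: ltnW.
  have e1 : (J%:R - K1%:R) / n%:R <= (J - K1)%:R / n%:R :> R.
    rewrite ler_pM2r ?invr_gt0// lerBlDr -natrD ler_nat; lia.
  rewrite lerBrDr; apply: le_trans (lerD (lexx _) e1) _.
  apply: le_trans (lerD (lexx _) (div_le _)) _.
  by rewrite -mulrDl ler_pdivrMr// mul1r -natrD ler_nat; lia.
Qed.
End Nodes.

(** * Convergence of the distribution functions *)

Lemma sample_angle_le (R : realType) M j (f : R) : (0 < M)%N ->
  (sample_angle R M j <= pi / 2 * f) = ((2 * j + 1)%:R <= M%:R * f).
Proof.
move=> M0; rewrite /sample_angle ler_pdivrMr; last by rewrite mulr_gt0// ltr0n.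
have -> : pi / 2 * f * (2 * M%:R) = M%:R * f * pi by field.
by rewrite ler_pM2r// pi_gt0.
Qed.

(** For [z = M f] this is a nearly maximal index whose sample angle is at most
    [pi / 2 * f]; the index [0] is also returned when there is none. *)
Lemma index_below (R : realType) (z : R) :
  exists K : nat, (0 < K)%N ==> (2 * K%:R + 1 <= z) /\ z < 2 * K%:R + 3.
Proof.
exists (Num.truncn ((z - 1) / 2)); split; last first.
  have : (z - 1) / 2 < (Num.truncn ((z - 1) / 2))%:R + 1 by rewrite natr1 truncnS_gt.
  by lra.
apply/implyP => K0; have : (Num.truncn ((z - 1) / 2))%:R <= (z - 1) / 2.
  by rewrite truncn_le; move: K0; rewrite truncn_gt0; lra.
by lra.
Qed.

(** The sample points reach the angle [tm], i.e. the quantile of order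
    [1 - e / 4]: at most a proportion [e / 4] of the zeros is missed beyond it, and
    the roundings of the indices cost at most three more zeros. *)
Lemma zero_cdf_close (R : realType) (p : {poly R}) (n M : nat) (e x : R)
    (tau := 1 - e / 4) (tm := pi / 2 * tau) :
  0 < e -> e <= 1 -> (size p <= n)%N -> (2 * n <= M)%N -> 4 / e <= n%:R ->
  (forall t, 0 < t -> t <= tm -> `|sin (M%:R * t)| = 1 ->
    0 < sin (M%:R * t) * p.[angle_point t]) ->
  `|limit_cdf x - fine (zero_cdf p x)| <= e.
Proof.
move=> e0 e1 sizep Mge ne signs; set F := limit_cdf x.
have /andP[F0 F1] := limit_cdf_itv x; rewrite -/F in F0 F1.
have pi2 : 0 < pi / 2 :> R by rewrite divr_gt0 ?pi_gt0.
have tau34 : 3 / 4 <= tau by rewrite /tau; lra.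
have tau1 : tau < 1 by rewrite /tau; lra.
have tmp : tm < pi / 2 by rewrite gtr_pMr.
have ne' : 4 <= n%:R * e by rewrite -ler_pdivrMr.
have n4 : 4 <= n%:R :> R by apply: le_trans ne' _; rewrite ler_piMr.
have n0 : 0 < n%:R :> R by lra.
have M0 : (0 < M)%N by rewrite (leq_trans _ Mge)// muln_gt0/= -(ltr0n R).
have Mn : 2 * n%:R <= M%:R :> R by rewrite -natrM ler_nat.
have dbl k : (2 * k + 1)%:R = 2 * k%:R + 1 :> R by rewrite natrD natrM.
have [J [J1 J2]] := index_below (M%:R * tau).
have Mtau : 2 * n%:R * tau <= M%:R * tau by rewrite ler_wpM2r//; lra.
have ntau : n%:R * (3 / 4) <= n%:R * tau by rewrite ler_wpM2l.
have J0 : (0 < J)%N.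
  by rewrite lt0n; apply/eqP => E; move: J2; rewrite E mulr0 add0r; lra.
rewrite J0/= in J1.
have nodeJ : sample_angle R M J <= tm by rewrite sample_angle_le// dbl.
have [K [K1 K2]] := index_below (M%:R * F).
have nodeK : pi / 2 * F < sample_angle R M K.+1.
  by rewrite ltNge sample_angle_le// -ltNge dbl -natr1; lra.
have nodeJK : (0 < minn J K)%N ==> (sample_angle R M (minn J K) <= pi / 2 * F).
  apply/implyP; rewrite leq_min => /andP[_ K0]; rewrite K0/= in K1.
  rewrite sample_angle_le// dbl; apply: le_trans K1.
  by rewrite lerD2r ler_wpM2l// ler_nat geq_minr.
have [v [-> v1 vlow vup]] := zero_cdf_bounds tmp M0 nodeJ signs
  (leq_trans sizep (leqnSn n)) J0 (geq_minl J K) nodeJK nodeK.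
have ntauE : n%:R * tau = n%:R - n%:R * e / 4 by rewrite /tau; field.
have nF : n%:R * F <= n%:R by rewrite ler_piMr// ltW.
have MF : 2 * n%:R * F <= M%:R * F by rewrite ler_wpM2r.
rewrite /= ler_distlC; apply/andP; split; rewrite -(ler_pM2l n0) ?mulrBr ?mulrDr.
  apply: (@le_trans _ _ (minn J K)%:R); last by rewrite mulrC -ler_pdivrMr.
  by rewrite /minn; case: ifP => _; lra.
(* When [tau < F] the trivial bound [v <= 1] is within [e / 4] of [F]. *)
have [tF|Ft] := ltP tau F.
  apply: (@le_trans _ _ n%:R); first by rewrite ler_piMr// ltW.
  have : n%:R * tau <= n%:R * F by rewrite ler_wpM2l// ltW.
  by lra.
have MtF : 2 * n%:R * (tau - F) <= M%:R * (tau - F) by rewrite ler_wpM2r// subr_ge0.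
have K1' : 2 * K%:R <= M%:R * F.
  case: (posnP K) K1 => [->|_ /=]; last by lra.
  by rewrite mulr0 mulr_ge0.
have : n%:R * v <= n%:R - (J%:R - K.+1%:R).
  by move: vup; rewrite -(ler_pM2l n0) mulrBr mulr1 mulrCA divff ?mulr1// gt_eqF.
by rewrite -natr1; lra.
Qed.

Lemma zero_cdf_cvg (R : realType) (P : nat -> {poly R}) (M : nat -> nat) :
  (forall n, (size (P n) <= n)%N) -> (forall n, (2 * n <= M n)%N) ->
  (forall tm : R, 0 < tm -> tm < pi / 2 -> exists N, forall n t, (N <= n)%N ->
    0 < t -> t <= tm -> `|sin ((M n)%:R * t)| = 1 ->
    0 < sin ((M n)%:R * t) * (P n).[angle_point t]) ->
  forall x, zero_cdf (P n) x @[n --> \oo] --> (limit_cdf x)%:E.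
Proof.
move=> sizeP Mge signs x.
apply/fine_cvgP; split; first by near=> n; rewrite zero_cdfE.
apply/cvgrPdist_le => e0 e00.
pose e := Num.min e0 1.
have e0' : 0 < e by rewrite lt_min e00 ltr01.
have e1 : e <= 1 by rewrite ge_min lexx orbT.
have pi2 : 0 < pi / 2 :> R by rewrite divr_gt0 ?pi_gt0.
have [||N HN] := signs (pi / 2 * (1 - e / 4)).
- by rewrite mulr_gt0//; lra.
- by rewrite gtr_pMr//; lra.
near=> n.
have ee : e <= e0 by rewrite ge_min lexx.
apply: le_trans ee; apply: (@zero_cdf_close _ _ n (M n)) => //.
  by near: n; exact: nbhs_infty_ger.
by move=> t; apply: HN; near: n; exact: nbhs_infty_ge.
Unshelve. all: by end_near. Qed.

Lemma size_Xi_tilde (R : realType) n : (size (Xi_tilde R n) <= n)%N.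
Proof.
rewrite Xi_tildeE; apply: leq_trans (size_scale_leq _ _) _.
by rewrite big_mkord -poly_def size_poly.
Qed.

Lemma size_Lambda_tilde (R : realType) n : (size (Lambda_tilde R n) <= n)%N.
Proof.
rewrite Lambda_tildeE; apply: leq_trans (size_scale_leq _ _) _.
by rewrite big_mkord -poly_def size_poly.
Qed.

Unset Implicit Arguments.

Theorem theorem16p3 (R : realType) :
  [/\ forall x : R,
        zero_cdf (Xi_tilde R n) x @[n --> \oo] --> (limit_cdf x)%:E,
      forall x : R,
        zero_cdf (Lambda_tilde R n) x @[n --> \oo] --> (limit_cdf x)%:E &
      forall x : R, {for x, continuous (@limit_cdf R)} ->
        zero_cdf (Xi_tilde R n) x @[n --> \oo] --> (limit_cdf x)%:E /\
        zero_cdf (Lambda_tilde R n) x @[n --> \oo] --> (limit_cdf x)%:E].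
Proof.
have Xi_cvg (x : R) : zero_cdf (Xi_tilde R n) x @[n --> \oo] --> (limit_cdf x)%:E.
  apply: (zero_cdf_cvg (@size_Xi_tilde R) (M := fun n => 2 * n)%N) => //.
  exact: Xi_tilde_sign.
have Lambda_cvg (x : R) :
    zero_cdf (Lambda_tilde R n) x @[n --> \oo] --> (limit_cdf x)%:E.
  apply: (zero_cdf_cvg (@size_Lambda_tilde R) (M := fun n => (2 * n).+1)%N) => //.
  exact: Lambda_tilde_sign.
by split.
Qed.
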